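(* Let $k\ge2$, $2\le s\le k$, and let $(d_1,\dots,d_{k+1})\in\mathbb Z_{\ge0}^{k+1}$. Put $$D=(\dots,d_{s-1},d_s+2,d_{s+1},\dots),\quad D'=(\dots,d_{s-1},d_s,d_{s+1},\dots),\quad D''=(\dots,d_{s-1}+1,d_s,d_{s+1}+1,\dots)$$ (all other entries equal to the corresponding $d_i$). Then $$\mathrm{ch}\,L^D=\mathrm{ch}\,L^{D'}+q^{\frac{p(D'')-p(D)}4+\frac{d_s+1}2}\,\mathrm{ch}\,L^{D''}.$$
   Context: For $D=(d_1,\dots,d_{k+1})\in\mathbb Z_{\ge0}^{k+1}$, $p(D)$ is the number of $i\in\{1,\dots,k\}$ for which $d_{i+1}+\cdots+d_{k+1}$ is odd. The fermionic space $F$: let $\psi(i),\phi(i)$, $i\in\mathbb Z$, be mutually anticommuting variables with zero squares. $F$ is the complex vector space with basis the semi-infinite monomials $\dots\psi(N-1)\phi(N-1)\psi(N)\phi(N)\,\psi(i_1)\cdots\psi(i_r)\,\phi(j_1)\cdots\phi(j_t)$, $N<i_1<\dots<i_r$, $N<j_1<\dots<j_t$. $\psi(i),\phi(i)$ act by right multiplication. Put $e_m=\sum_{i+j=m}\psi(i)\phi(j)$; these commute and act on $F^{\otimes k}$ by the coproduct. Put $v(2N)=\dots\psi(N-1)\phi(N-1)\psi(N)$, $v(2N+1)=\dots\psi(N-1)\phi(N-1)\psi(N)\phi(N)$. The grading operators $h_0$ and $d$ act diagonally on monomials of $F$: $h_0v(0)=dv(0)=0$, $[h_0,\psi(i)]=\psi(i)$,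 $[h_0,\phi(i)]=\phi(i)$, $[d,\psi(i)]=i\psi(i)$, $[d,\phi(i)]=i\phi(i)$; they act on $F^{\otimes k}$ additively. Definition of $L^D$: let $n=d_1+\cdots+d_{k+1}$ and $\beta_i=d_{i+1}+\cdots+d_{k+1}$, $1\le i\le k$. For $r\ge1$ put $$w_r=v(-\beta_1-2r)\otimes\cdots\otimes v(-\beta_k-2r),\qquad M_r=\mathbb C[e_{-(n+2r)+1},\dots,e_{-1},e_0]\,w_r\subset F^{\otimes k}.$$ These form an increasing chain and $L^D=\bigcup_{r\ge1}M_r$ (it depends on $d_{k+1}$ only through its parity, so one may always take $d_{k+1}\in\{0,1\}$). Its character is $\mathrm{ch}\,L^D=\mathrm{Tr}_{L^D}\,q^dz^{h_0/2}$. *)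

(* Defs.v *)
From HB Require Import structures.
From mathcomp Require Import all_boot all_order all_algebra.
From mathcomp Require Import finmap monalg zify.
From mathcomp Require Import boolp classical_sets cardinality fsbigop.
From mathcomp Require Import reals complex.

Set Implicit Arguments.
Unset Strict Implicit.
Unset Printing Implicit Defensive.

Import Order.TTheory GRing.Theory Num.Theory.

Local Open Scope classical_set_scope.
Local Open Scope ring_scope.

Section Linear.
Variables (K : fieldType) (V : lmodType K).

(* The linear map from the free vector space on [B] with values [f] on the
   basis. *)
Definition linext (B : choiceType) (f : B -> V) (u : {malg K[B]}) : V :=
  \sum_(b <- msupp u) u@_b *: f b.

Definition lspan (A : set V) : set V :=
  [set v | exists n (c : 'I_n -> K) (u : 'I_n -> V),
     (forall i, A (u i)) /\ v = \sum_(i < n) c i *: u i].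

Definition lfree n (b : 'I_n -> V) : Prop :=
  forall c : 'I_n -> K, \sum_(i < n) c i *: b i = 0 -> forall i, c i = 0.

Definition has_dim (A : set V) (n : nat) : Prop :=
  exists b : 'I_n -> V,
    [/\ forall i, A (b i), lfree b &
        forall v, A v -> exists c : 'I_n -> K, v = \sum_(i < n) c i *: b i].

(* By convention 0 if [A] is not finite-dimensional; [weight_has_dim] below
   shows that this case does not occur where [dim] is used. *)
Definition dim (A : set V) : nat := xget 0%N [set n | has_dim A n].

Lemma lfree_leq n m (b : 'I_n -> V) (b' : 'I_m -> V) :
    lfree b -> (forall i, exists c : 'I_m -> K, b i = \sum_j c j *: b' j) ->
  (n <= m)%N.
Proof.
move=> bfree /choice[c bE]; rewrite leqNgt; apply/negP => ltmn.
pose A := (\matrix_(i < n, j < m) c i j : 'M[K]_(n, m)).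
have : kermx A != 0.
  by rewrite -mxrank_eq0 mxrank_ker subn_eq0 -ltnNge (leq_ltn_trans _ ltmn) ?rank_leq_col.
case/rowV0Pn => r /sub_kermxP rA /eqP; apply; apply/rowP => i; rewrite mxE.
apply: (bfree (fun i => r 0 i)).
under eq_bigr do rewrite bE scaler_sumr.
rewrite exchange_big /= big1 // => j _.
under eq_bigr do rewrite scalerA.
rewrite -scaler_suml.
have /rowP/(_ j) := rA; rewrite !mxE => rAj.
rewrite (_ : \sum_i _ = 0) ?scale0r //.
by rewrite -[RHS]rAj; apply: eq_bigr => l _; rewrite mxE.
Qed.

Lemma has_dim_uniq (A : set V) n m : has_dim A n -> has_dim A m -> n = m.
Proof.
move=> [b [Ab bf bg]] [b' [Ab' bf' bg']]; apply/eqP; rewrite eqn_leq.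
by apply/andP; split; [apply: (lfree_leq (b' := b') bf) => i; exact: bg'
                      |apply: (lfree_leq (b' := b) bf') => i; exact: bg].
Qed.

Lemma has_dim_ex (A : set V) m (b' : 'I_m -> V) :
    (forall v, A v -> exists c : 'I_m -> K, v = \sum_j c j *: b' j) ->
  exists n, has_dim A n.
Proof.
move=> Ab'.
pose P n := `[< exists b : 'I_n -> V, (forall i, A (b i)) /\ lfree b >].
have exP : exists n, P n.
  by exists 0%N; apply/asboolP; exists (fun _ => 0); split=> [[]//|c _ []].
have leP n : P n -> (n <= m)%N.
  by move=> /asboolP[b [Ab bf]]; apply: (lfree_leq bf) => i; apply: Ab'.
case: (ex_maxnP exP leP) => n /asboolP[b [Ab bf]] nmax; exists n, b; split=> // v Av.
apply: contrapT => nv.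
have /nmax : P n.+1; last by rewrite ltnn.
apply/asboolP; exists (fun i => oapp b v (unlift ord0 i)); split.
  by move=> i; case: unliftP => [j|] _ //=.
move=> c; rewrite big_ord_recl unlift_none /=.
under eq_bigr do rewrite liftK /=.
have [c0|c0] := eqVneq (c ord0) 0.
  rewrite c0 scale0r add0r => /bf cl i.
  by case: (unliftP ord0 i) => [j|] -> //; exact: cl.
move=> /eqP; rewrite addr_eq0 => /eqP cv; case: nv.
exists (fun i => - (c ord0)^-1 * c (lift ord0 i)).
under eq_bigr do rewrite -scalerA.
by rewrite -scaler_sumr scaleNr -scalerN -cv scalerA mulVf // scale1r.
Qed.

Lemma dimP (A : set V) n : has_dim A n -> dim A = n.
Proof.
move=> An; rewrite /dim; apply: xget_unique => // m Am.
exact: has_dim_uniq Am An.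
Qed.

End Linear.

(* The semi-infinite monomials.  The mode psi(i) is placed at position 2i and
   phi(i) at position 2i+1, so that the vacuum ...psi(N)phi(N) is written in
   increasing order of positions.  A monomial is, up to sign, the set of
   positions of its factors; that set contains almost all negative positions
   and almost no positive one, and is encoded by its symmetric difference with
   the set {x <= 0} of v(0).  The basis vector attached to a state is the
   monomial with its factors in increasing order of positions; those of the
   form ...psi(N)phi(N)psi(i_1)...psi(i_r)phi(j_1)...phi(j_t) agree with it up
   to sign (and agree among themselves only up to sign when N varies). *)
Notation state := {fset int}.

Definition occupied (S : state) (p : int) : bool := (p <= 0) (+) (p \in S).

Definition fill (S : state) (p : int) : state :=
  (if p \in S then S `\ p else p |` S)%fset.

Definition num_above (S : state) (p : int) : nat :=
  #|` fset_set [set x : int | (p < x) && occupied S x]|.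

(* The state of v(m): exactly the positions x <= m are occupied. *)
Definition vac (m : int) : state :=
  fset_set [set x : int | (x <= m) (+) (x <= 0)].

(* Eigenvalues of d and h_0.  A position in [S] is an additional factor
   relative to v(0) if positive and a missing one otherwise; the mode at
   position p has d-degree floor(p/2) and h_0-degree 1. *)
Definition energy (S : state) : int :=
  \sum_(p <- S) if 0 < p then (p %/ 2)%Z else - (p %/ 2)%Z.

Definition charge (S : state) : int :=
  \sum_(p <- S) if 0 < p then 1 else - 1.

Section Fock.
Variable K : fieldType.

Definition F := {malg K[state]}.

(* Right multiplication by the mode at position [p]: it anticommutes past the
   factors at larger positions. *)
Definition rmul (p : int) : F -> F :=
  linext (fun S : state => if occupied S p then 0 : F
            else (-1) ^+ num_above S p *: (<< fill S p >> : F)).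

Definition psi (i : int) : F -> F := rmul (2 * i).
Definition phi (i : int) : F -> F := rmul (2 * i + 1).

(* [u] times the sum of the psi(i)phi(m-i).  The sum is over the finitely
   many nonzero terms, see [eF_finite]. *)
Definition eF (m : int) (u : F) : F :=
  \sum_(i \in [set: int]) phi (m - i) (psi i u).

Variable k : nat.

(* The k-th tensor power of [F], through its basis of pure tensors of states. *)
Definition Fk := {malg K[{ffun 'I_k -> state}]}.

(* id (x) ... (x) g (x) ... (x) id with [g] in position [a]; no sign occurs
   because this is only used for the even operators [eF m]. *)
Definition act_at (a : 'I_k) (g : F -> F) : Fk -> Fk :=
  linext (fun X : {ffun 'I_k -> state} =>
    linext (fun S : state =>
        << [ffun b => if b == a then S else X b] >> : Fk) (g << X a >>)).

Definition e (m : int) (u : Fk) : Fk := \sum_(a < k) act_at a (eF m) u.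

Definition d_op : Fk -> Fk :=
  linext (fun X : {ffun 'I_k -> state} =>
    ((\sum_(a < k) energy (X a))%:~R : K) *: (<< X >> : Fk)).

Definition h0_op : Fk -> Fk :=
  linext (fun X : {ffun 'I_k -> state} =>
    ((\sum_(a < k) charge (X a))%:~R : K) *: (<< X >> : Fk)).

End Fock.

(* D = (d_1, ..., d_{k+1}) is indexed from 0: [D j] is d_{j+1}, and
   [beta D a] is beta_{a+1}. *)
Section Modules.
Variables (k : nat) (D : {ffun 'I_k.+1 -> nat}).

Definition beta (a : 'I_k) : nat := (\sum_(j < k.+1 | a < j) D j)%N.

Definition parity : nat := #|[set a : 'I_k | odd (beta a)]%SET|.

Definition total : nat := (\sum_(j < k.+1) D j)%N.

Variable K : fieldType.

Definition w (r : nat) : Fk K k :=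
  << [ffun a : 'I_k => vac (- (beta a)%:Z - (2 * r)%N%:Z)] >>.

(* C[e_{-(n+2r)+1}, ..., e_0] w_r: the span of the vectors e_{m_1}...e_{m_l} w_r
   with all indices in the given range. *)
Definition M (r : nat) : set (Fk K k) :=
  lspan [set u | exists2 ms : seq int,
    all (fun m => - (total + 2 * r)%N%:Z + 1 <= m <= 0) ms &
    u = foldr (@e K k) (w r) ms].

Definition L : set (Fk K k) := [set u | exists2 r : nat, (1 <= r)%N & M r u].

End Modules.

Arguments L [k] D K _.


Section Character.
Variables (K : numFieldType) (k : nat).

Definition weight_space (A : set (Fk K k)) (a b : rat) : set (Fk K k) :=
  [set u | [/\ A u, d_op u = ratr a *: u & 2^-1 *: h0_op u = ratr b *: u]].

(* The coefficient of q^a z^b in Tr_A q^d z^(h_0/2). *)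
Definition ch (A : set (Fk K k)) (a b : rat) : nat := dim (weight_space A a b).

End Character.

(* q^c times a formal series. *)
Definition qmul (c : rat) (f : rat -> rat -> nat) : rat -> rat -> nat :=
  fun a b => f (a - c) b.

(* The sums and cardinals used above are finite, and so are the dimensions
   defining [ch]. *)

Lemma finite_itv (a b : int) : finite_set [set x : int | a <= x <= b].
Proof.
apply: (sub_finite_set _ (finite_seq [seq a + i%:Z | i <- iota 0 `|b - a|.+1])).
move=> x /andP[ax xb]; apply/mapP; exists `|x - a|%N; last by lia.
by rewrite mem_iota; lia.
Qed.

Lemma occupied_vac m x : occupied (vac m) x = (x <= m).
Proof.
rewrite /occupied /vac in_fset_set; last first.
  apply: sub_finite_set (finite_itv (- `|m|) `|m|) => y /=.
  by case: (lerP y m); case: (lerP y 0) => //=; lia.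
by rewrite mem_setE /= addbC addbK.
Qed.

Lemma occupied_fill S p q : ~~ occupied S p ->
  occupied (fill S p) q = (q == p) || occupied S q.
Proof.
rewrite /occupied /fill; have [->|qp] := eqVneq q p.
  by case: ifP => pS; rewrite !inE eqxx ?pS; case: (p <= 0).
by case: ifP => pS; rewrite !inE (negPf qp).
Qed.

Lemma energy_fill S p : ~~ occupied S p ->
  energy (fill S p) = energy S + (p %/ 2)%Z.
Proof.
rewrite /occupied /fill /energy; case: ifP => pS.
  case: (lerP p 0) => // p0 _; rewrite [in RHS](big_fsetD1 p) //= ltNge p0 /=.
  by rewrite addrAC addNr add0r.
case: (lerP p 0) => // p0 _; rewrite big_fsetU1 ?pS //= p0.
by rewrite addrC.
Qed.

Lemma charge_fill S p : ~~ occupied S p -> charge (fill S p) = charge S + 1.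
Proof.
rewrite /occupied /fill /charge; case: ifP => pS.
  case: (lerP p 0) => // p0 _; rewrite [in RHS](big_fsetD1 p) //= ltNge p0 /=.
  by rewrite addrAC addNr add0r.
by case: (lerP p 0) => // p0 _; rewrite big_fsetU1 ?pS //= p0 addrC.
Qed.

Lemma ler_sum_mem (f : int -> int) (S : state) p :
  (forall x, 0 <= f x) -> p \in S -> f p <= \sum_(x <- S) f x.
Proof.
by move=> f0 pS; rewrite (big_fsetD1 p) //= lerDl; apply: sumr_ge0 => x _.
Qed.

Lemma unoccupied_ge S p : ~~ occupied S p -> - (\sum_(x <- S) `|x|) <= p.
Proof.
have N0 : 0 <= \sum_(x <- S) `|x| by apply: sumr_ge0.
rewrite /occupied; case: (lerP p 0) => [p0 /negPn pS|p0 _].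
  rewrite lerNl; apply: le_trans (ler_norm (- p)) _; rewrite normrN.
  exact: (ler_sum_mem (f := fun x => `|x|) (fun x => normr_ge0 x) pS).
by apply: le_trans (ltW p0); rewrite oppr_le0.
Qed.

Lemma num_above_finite S p : finite_set [set x : int | (p < x) && occupied S x].
Proof.
apply: (sub_finite_set _ (finite_itv p (\sum_(x <- S) `|x|))) => x /= /andP[px].
have N0 : 0 <= \sum_(x <- S) `|x| by apply: sumr_ge0.
rewrite /occupied (ltW px) /=; case: (lerP x 0) => [x0 _|x0 xS].
  exact: le_trans N0.
exact: le_trans (ler_norm x) (ler_sum_mem (f := fun x => `|x|) (fun x => normr_ge0 x) xS).
Qed.

Section Finiteness.
Variable K : fieldType.

Lemma msupp_linext (B C : choiceType) (f : B -> {malg K[C]}) u x :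
  x \in msupp (linext f u) -> exists2 b, b \in msupp u & x \in msupp (f b).
Proof.
rewrite -mcoeff_neq0 /linext raddf_sum /= => nz; apply: contrapT => nb.
case/negP: nz; rewrite big_seq big1 // => b bu.
rewrite mcoeffZ (mcoeff_outdom (g := f b)) ?mulr0 //.
by apply/negP => xb; apply: nb; exists b.
Qed.

Lemma malg0P (B : choiceType) (u : {malg K[B]}) :
  (forall b, b \notin msupp u) -> u = 0.
Proof. by move=> u0; apply/malgP => b; rewrite mcoeff0 mcoeff_outdom. Qed.

Lemma msupp_rmul p (u : F K) T : T \in msupp (rmul p u) ->
  exists S, [/\ S \in msupp u, ~~ occupied S p & T = fill S p].
Proof.
case/msupp_linext => S Su; case: ifP => oS; first by rewrite msupp0.
move=> TS; exists S; split; rewrite ?oS //; move: TS.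
rewrite -mcoeff_neq0 mcoeffZ mcoeffU; case: (fill S p =P T) => [-> //|_].
by rewrite mulr0 eqxx.
Qed.

Lemma eF_finite m (u : F K) :
  finite_set [set i : int | phi (m - i) (psi i u) != 0].
Proof.
pose N : int := \sum_(S <- msupp u) \sum_(x <- S) `|x|.
apply: (sub_finite_set _ (finite_itv (- N) (N + m + 1))) => i /=.
move=> nz; have [T] : exists T, T \in msupp (phi (m - i) (psi i u)).
  apply: contrapT => nT; case/eqP: nz; apply: malg0P => T.
  by apply/negP => Tu; apply: nT; exists T.
case/msupp_rmul => T' [+ + _] => /msupp_rmul[S [Su oS ->]]; rewrite occupied_fill // negb_or => /andP[_ oS'].
have SN : \sum_(x <- S) `|x| <= N.
  by rewrite /N (big_fsetD1 S) //= lerDl; do 2 apply: sumr_ge0 => ? _.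
have S0 : 0 <= \sum_(x <- S) `|x| by apply: sumr_ge0.
have := unoccupied_ge oS; have := unoccupied_ge oS'; move: S0 SN.
by move: (\sum_(x <- S) _) N => s N; lia.
Qed.

End Finiteness.

Lemma energy_ge0 (S : state) : 0 <= energy S.
Proof. by apply: sumr_ge0 => p _; case: ifP => p0; lia. Qed.

Lemma energy_bound (S : state) p : p \in S -> `|p| <= 2 * energy S + 1.
Proof.
move=> pS.
have := ler_sum_mem (f := fun x => if 0 < x then (x %/ 2)%Z else - (x %/ 2)%Z) _ pS.
by rewrite -/(energy S) => /(_ _)/wrap[x|]; case: ifP => x0; lia.
Qed.

Lemma weight_has_dim (K : numFieldType) k (A : set (Fk K k)) a b :
  exists n, has_dim (weight_space A a b) n.
Proof.
pose en (X : {ffun 'I_k -> state}) := \sum_(i < k) energy (X i).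
have supp u X : weight_space A a b u -> X \in msupp u -> (en X)%:~R = ratr a :> K.
  move=> [_ + _] Xu => /(congr1 (mcoeff X)).
  rewrite mcoeffZ /d_op /linext raddf_sum /= (big_fsetD1 X) //= big1_fset; last first.
    move=> Y; rewrite !inE => /andP[/negPf YX _] _.
    by rewrite !mcoeffZ mcoeffU YX !mulr0.
  rewrite addr0 !mcoeffZ mcoeffUU mulr1 mulrC; apply: mulIf.
  by rewrite mcoeff_neq0.
have [[E aE]|nE] := pselect (exists E : int, E%:~R = ratr a :> K); last first.
  apply: (@has_dim_ex K (Fk K k) _ 0 (fun=> 0)) => u uA; exists (fun=> 0).
  by rewrite big_ord0; apply: malg0P => X; apply/negP => /(supp _ _ uA) enX; apply: nE; exists (en X).
pose B : {fset int} := fset_set [set x : int | - (2 * E + 1) <= x <= 2 * E + 1].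
pose st (f : {ffun 'I_k -> fpowerset B}) : {ffun 'I_k -> state} := [ffun i => val (f i)].
pose Q : {fset {ffun 'I_k -> state}} := [fset X in codom st]%fset.
pose X0 : {ffun 'I_k -> state} := [ffun=> fset0].
apply: (@has_dim_ex K (Fk K k) _ #|` Q| (fun j => << nth X0 Q j >>)) => u uA.
exists (fun j => u@_(nth X0 Q j)).
have uQ : (msupp u `<=` Q)%fset.
  apply/fsubsetP => X Xu; have := supp _ _ uA Xu; rewrite -aE => /intr_inj enX.
  have XB i : X i \in fpowerset B.
    rewrite fpowersetE; apply/fsubsetP => p pX; rewrite in_fset_set; last exact: finite_itv.
    rewrite mem_setE /=; have := energy_bound pX.
    suff : energy (X i) <= E by lia.
    by rewrite -enX /en (bigD1 i) //= lerDl; apply: sumr_ge0 => j _; apply: energy_ge0.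
  rewrite inE; apply/codomP; exists [ffun i => [` XB i]%fset].
  by apply/ffunP => i; rewrite !ffunE.
rewrite {1}(monalgEw uQ) (big_nth X0) big_mkord; apply: eq_bigr => j _.
by apply/malgP => Y; rewrite mcoeffZ !mcoeffU; case: eqP; rewrite ?mulr1 ?mulr0.
Qed.

(* Main.v *)
(** Write w_f for the tensor product of the vacua v(-b_a), and M_f for the span
    of its descendants under the e_m, m <= 0; for large r the modules of the
    theorem are of this form, and the weight spaces of L^D are those of M_f.

    Moving the top fermion of component s to the first hole of component s - 1
    is the only nonzero contribution, on w^D, of an operator T (an element of
    the affine sp(2k) commuting with sl_2) that commutes with every e_m.  Hence
    T maps M^D onto M^(D''), and it kills the vector w^(D').  It remains to see
    that w^(D') lies in M^D and that the kernel of T on M^D is no larger than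
    M^(D'), and both follow from dim M_f = prod_l (N_l + 1), where N_l is the
    number of components a with b_a >= l.

    Upper bound: e_m is the lowest-energy part of a combination of commuting
    operators y_l with y_l ^ (N_l + 1) = 0 (deform the modes C[x]/x^b to b
    distinct points), so that M_f is contained in the space of lowest-energy
    parts of the span of the monomials in the y_l applied to w_f.  Lower bound:
    by induction, an exact sequence of the same kind, in which the submodule is
    generated by a power of the lowest e_m, gives the recursion of the product
    formula; it needs spare components with b_a = 0, on which the e_m, m <= 0,
    act by zero.  Once the dimensions agree, M_f contains all those
    lowest-energy parts, in particular that of y_l ^ N_l w_f, which is
    w^(D') for a suitable l. *)

From mathcomp Require Import all_boot all_order all_algebra zify ring lra.
From mathcomp Require Import boolp.

Set Implicit Arguments.
Unset Strict Implicit.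
Unset Printing Implicit Defensive.

Import Order.TTheory GRing.Theory Num.Theory.

Local Open Scope ring_scope.

(** * Finite exterior algebra *)

Section Fermions.
Variables (K : fieldType) (J : finType) (rk : J -> nat).
Hypothesis rk_inj : injective rk.
Implicit Types (i j : J) (S T : {set J}).

(** The exterior algebra on [J], as row vectors indexed by subsets: operators act on the right, like
    the modes on [F]. *)
Definition fdim := #|{: {set J}}|.

Definition rnk (S : {set J}) : 'I_fdim := enum_rank S.
Definition stt (s : 'I_fdim) : {set J} := enum_val s.

Lemma rnkK : cancel rnk stt. Proof. exact: enum_rankK. Qed.
Lemma sttK : cancel stt rnk. Proof. exact: enum_valK. Qed.

Definition ket (S : {set J}) : 'rV[K]_fdim := delta_mx 0 (rnk S).

(** Same rule as [num_above]: a mode multiplied from the right passes the factors of larger rank. *)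
Definition fsign (j : J) (S : {set J}) : K := (-1) ^+ #|[set i in S | (rk j < rk i)%N]|.

Definition cre (j : J) : 'M[K]_fdim :=
  \matrix_s (if j \in stt s then 0 else fsign j (stt s) *: ket (j |: stt s)).

Definition ann (j : J) : 'M[K]_fdim :=
  \matrix_s (if j \in stt s then fsign j (stt s) *: ket (stt s :\ j) else 0).

Lemma ket_mul S (A : 'M[K]_fdim) : ket S *m A = row (rnk S) A.
Proof. by rewrite -rowE. Qed.

Lemma ket_cre S j :
  ket S *m cre j = if j \in S then 0 else fsign j S *: ket (j |: S).
Proof. by rewrite ket_mul rowK rnkK. Qed.

Lemma ket_ann S j :
  ket S *m ann j = if j \in S then fsign j S *: ket (S :\ j) else 0.
Proof. by rewrite ket_mul rowK rnkK. Qed.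

Lemma mx_ketP (A B : 'M[K]_fdim) : (forall S, ket S *m A = ket S *m B) -> A = B.
Proof.
by move=> eqAB; apply/row_matrixP => s; have := eqAB (stt s); rewrite !ket_mul sttK.
Qed.

Lemma sg_add j i S : i \notin S ->
  fsign j (i |: S) = (if (rk j < rk i)%N then -1 else 1) * fsign j S.
Proof.
move=> iS; rewrite /fsign; case: ifP => ji.
  have -> : [set l in i |: S | (rk j < rk l)%N] = i |: [set l in S | (rk j < rk l)%N].
    by apply/setP => l; rewrite !inE; case: eqP => // ->.
  by rewrite cardsU1 inE (negPf iS) /= exprS.
rewrite mul1r; congr (_ ^+ _); apply: eq_card => l; rewrite !inE.
by have [->|//] := eqVneq l i; rewrite ji !andbF.
Qed.

Lemma sg_del j i S : i \in S ->
  fsign j (S :\ i) = (if (rk j < rk i)%N then -1 else 1) * fsign j S.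
Proof.
move=> iS; rewrite -{2}(setD1K iS) [in RHS]sg_add ?setD11 // mulrA.
by case: ifP => _; rewrite ?mulrNN mulr1 mul1r.
Qed.

Lemma sg_sq j S : fsign j S * fsign j S = 1.
Proof. by rewrite -expr2 sqrr_sign. Qed.

Lemma rk_swap (i j : J) : i != j ->
  (if (rk i < rk j)%N then -1 else 1) = - (if (rk j < rk i)%N then -1 else 1) :> K.
Proof.
move=> ij; case: ltngtP => // [_|/rk_inj eij]; first by rewrite opprK.
by rewrite eij eqxx in ij.
Qed.

Lemma cre_sq j : cre j *m cre j = 0.
Proof.
apply: mx_ketP => S; rewrite mulmxA mulmx0 ket_cre; case: ifP => jS.
  by rewrite mul0mx.
by rewrite -scalemxAl ket_cre setU11 scaler0.
Qed.

Lemma cre_anti i j : cre i *m cre j = - (cre j *m cre i).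
Proof.
have [->|ij] := eqVneq i j; first by rewrite cre_sq oppr0.
apply: mx_ketP => S; rewrite mulmxN !mulmxA !ket_cre.
case: (boolP (i \in S)) => iS; case: (boolP (j \in S)) => jS;
  rewrite ?mul0mx ?oppr0 // -?scalemxAl ?ket_cre ?inE ?iS ?jS ?orbT ?scaler0 ?oppr0 //.
rewrite (negPf ij) eq_sym (negPf ij) /= (negPf iS) (negPf jS) !scalerA !sg_add // setUCA -scaleNr.
congr (_ *: _); rewrite (rk_swap ij); ring.
Qed.

(** With [cre_anti], the canonical anticommutation relations; for distinct modes the two terms
    cancel by [rk_swap]. *)
Lemma ann_cre i j : ann i *m cre j + cre j *m ann i = (i == j)%:R%:M.
Proof.
apply: mx_ketP => S; rewrite mulmxDr !mulmxA mul_mx_scalar ket_ann ket_cre.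
have [->|ij] := eqVneq i j.
  case: (boolP (j \in S)) => jS.
    by rewrite mul0mx addr0 -scalemxAl ket_cre setD11 scalerA setD1K // sg_del // ltnn mul1r sg_sq.
  by rewrite mul0mx add0r -scalemxAl ket_ann setU11 scalerA setU1K // sg_add // ltnn mul1r sg_sq.
rewrite scale0r; case: (boolP (i \in S)) => iS; case: (boolP (j \in S)) => jS;
  rewrite ?mul0mx ?addr0 ?add0r -?scalemxAl ?ket_cre ?ket_ann ?inE ?iS ?jS ?orbT ?andbT ?scaler0 ?addr0 //.
- by rewrite eq_sym (negPf ij) /= scaler0.
- have -> : (j |: S) :\ i = j |: (S :\ i).
    by apply/setP => l; rewrite !inE; case: eqP => // -> /=; rewrite (negPf ij).
  rewrite eq_sym ij /= (negPf jS) !scalerA sg_del // sg_add // -scalerDl.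
  by rewrite (rk_swap ij) [X in X *: _](_ : _ = 0) ?scale0r //; ring.
- by rewrite (negPf ij) (negPf iS) scaler0.
Qed.

Lemma ket_neq0 S : ket S != 0.
Proof.
apply/eqP => /(congr1 (fun u : 'rV[K]_fdim => u 0 (rnk S))).
by rewrite !mxE !eqxx; apply/eqP; rewrite oner_eq0.
Qed.

Lemma sg_neq0 j S : fsign j S != 0.
Proof. by rewrite signr_eq0. Qed.

End Fermions.

(** * Cyclic subspaces and filtrations *)

Section Subspaces.
Variables (K : fieldType) (m : nat).
Implicit Types (u v w : 'rV[K]_m) (A : 'M[K]_m).

(** Subspaces as predicates: conditions can be combined freely before a spanning matrix is produced
    by [linpred_mx]. *)
Record linpred (P : 'rV[K]_m -> Prop) : Prop := LinPred {
  linpred0 : P 0;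
  linpredD : forall c u v, P u -> P v -> P (c *: u + v) }.

(** A subspace of maximal rank among those contained in [P] absorbs every vector of [P], since
    adding one would raise the rank. *)
Lemma linpred_mx (P : 'rV[K]_m -> Prop) : linpred P ->
  exists A, forall u, (u <= A)%MS <-> P u.
Proof.
move=> linP; pose Q n := `[< exists A, \rank A = n /\ forall u, (u <= A)%MS -> P u >].
have exQ : exists n, Q n.
  exists 0%N; apply/asboolP; exists 0; split; first exact: mxrank0.
  by move=> u /submx0null ->; exact: (linpred0 linP).
have leQ n : Q n -> (n <= m)%N by move=> /asboolP[A [<- _]]; exact: rank_leq_row.
case: (ex_maxnP exQ leQ) => n /asboolP[A [An AP]] nmax; exists A => u; split; first exact: AP.
move=> Pu; have /nmax : Q (\rank (A + u)%MS).
  apply/asboolP; exists (A + u)%MS; split=> // v /sub_addsmxP[[x y] /= ->].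
  rewrite -[x *m A]scale1r; apply: (linpredD linP); first by apply: AP; exact: submxMl.
  rewrite [y]mx11_scalar mul_scalar_mx -[_ *: _]addr0.
  exact: (linpredD linP _ Pu (linpred0 linP)).
rewrite -An => rAu; have := mxrank_leqif_sup (addsmxSl A u) => /leqifP.
case: ifP => [/(submx_trans (addsmxSr A u)) //|_]; lia.
Qed.

Lemma linpred_sub n (A : 'M[K]_(n, m)) : linpred (fun u => (u <= A)%MS).
Proof.
split=> [|c u v uA vA]; first exact: sub0mx.
by rewrite addmx_sub // scalemx_sub.
Qed.

Lemma linpred_mul n (B : 'M[K]_m) (A : 'M[K]_(n, m)) : linpred (fun u => (u *m B <= A)%MS).
Proof.
split=> [|c u v uA vA]; first by rewrite mul0mx sub0mx.
by rewrite mulmxDl -scalemxAl addmx_sub // scalemx_sub.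
Qed.

Lemma linpred_and (P Q : 'rV[K]_m -> Prop) :
  linpred P -> linpred Q -> linpred (fun u => P u /\ Q u).
Proof.
move=> linP linQ; split=> [|c u v [Pu Qu] [Pv Qv]]; split.
- exact: (linpred0 linP).
- exact: (linpred0 linQ).
- exact: (linpredD linP _ Pu Pv).
- exact: (linpredD linQ _ Qu Qv).
Qed.

Lemma linpred_all (I : Type) (P : I -> 'rV[K]_m -> Prop) :
  (forall i, linpred (P i)) -> linpred (fun u => forall i, P i u).
Proof.
move=> linP; split=> [i|c u v Pu Pv i]; first exact: (linpred0 (linP i)).
exact: (linpredD (linP i) _ (Pu i) (Pv i)).
Qed.

Lemma linpred_imp (P : Prop) (Q : 'rV[K]_m -> Prop) :
  linpred Q -> linpred (fun u => P -> Q u).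
Proof.
move=> linQ; split=> [_|c u v Pu Pv p]; first exact: (linpred0 linQ).
exact: (linpredD linQ _ (Pu p) (Pv p)).
Qed.

Section Cyclic.
Variables (I : Type) (E : I -> 'M[K]_m).

(** The submodule generated by [w], as the intersection of all stable subspaces through [w]; no
    monomials in the [E i] have to be listed. *)
Definition cycp w u :=
  forall A, (w <= A)%MS /\ (forall i v, (v <= A)%MS -> (v *m E i <= A)%MS) -> (u <= A)%MS.

Lemma cycp_lin w : linpred (cycp w).
Proof. by apply: linpred_all => A; apply: linpred_imp; exact: linpred_sub. Qed.

Definition cyc w : 'M[K]_m := sval (cid (linpred_mx (cycp_lin w))).

Lemma cycE w u : (u <= cyc w)%MS <-> cycp w u.
Proof. by rewrite /cyc; case: cid. Qed.

Lemma cyc_id w : (w <= cyc w)%MS.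
Proof. by apply/cycE => A []. Qed.

Lemma cyc_stable w i u : (u <= cyc w)%MS -> (u *m E i <= cyc w)%MS.
Proof. by move=> /cycE uw; apply/cycE => A [wA EA]; exact: (EA _ _ (uw _ (conj wA EA))). Qed.

(** The vectors of [cyc w] satisfying [P] form a stable subspace through [w], hence exhaust
    [cyc w]. *)
Lemma cyc_ind w (P : 'rV[K]_m -> Prop) : linpred P -> P w ->
    (forall i u, (u <= cyc w)%MS -> P u -> P (u *m E i)) ->
  forall u, (u <= cyc w)%MS -> P u.
Proof.
move=> linP Pw PE u uw; pose Q v := (v <= cyc w)%MS /\ P v.
have linQ : linpred Q by apply: linpred_and; first exact: linpred_sub.
have [A AQ] := linpred_mx linQ.
suff /AQ[] : (u <= A)%MS by [].
move/cycE: uw; apply; split; first by apply/AQ; split=> //; exact: cyc_id.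
by move=> i v /AQ[vw Pv]; apply/AQ; split; [exact: cyc_stable|exact: PE].
Qed.

Lemma cyc_sub w A : (w <= A)%MS -> (forall i u, (u <= A)%MS -> (u *m E i <= A)%MS) ->
  (cyc w <= A)%MS.
Proof.
move=> wA EA; apply/row_subP => r; move: (row_sub r (cyc w)).
by move/cycE; apply; split.
Qed.

Lemma cyc_subc w w' : (w' <= cyc w)%MS -> (cyc w' <= cyc w)%MS.
Proof. by move=> w'w; apply: cyc_sub => // i u; exact: cyc_stable. Qed.

Lemma cyc_comm w T : (forall i, E i *m T = T *m E i) ->
  (cyc (w *m T) :=: cyc w *m T)%MS.
Proof.
move=> ET; apply/eqmxP/andP; split.
  apply: cyc_sub => [|i u /submxP[r ->]]; first by apply: submxMr; exact: cyc_id.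
  rewrite -!mulmxA -ET !mulmxA submxMr //; apply: cyc_stable; exact: submxMl.
apply/row_subP => r; rewrite row_mul.
apply: (cyc_ind (P := fun u => (u *m T <= cyc (w *m T))%MS)) (row_sub r _).
- exact: linpred_mul.
- exact: cyc_id.
- by move=> i u _ uT; rewrite -mulmxA ET mulmxA; exact: cyc_stable.
Qed.

Lemma cyc_scale c w : c != 0 -> (cyc (c *: w) :=: cyc w)%MS.
Proof.
move=> c0; apply/eqmxP/andP; split; apply: cyc_subc.
  by apply: scalemx_sub; exact: cyc_id.
by have := scalemx_sub c^-1 (cyc_id (c *: w)); rewrite scalerK.
Qed.

Lemma cyc_kill w T : (forall i, E i *m T = T *m E i) -> w *m T = 0 ->
  forall u, (u <= cyc w)%MS -> u *m T = 0.
Proof.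
move=> ET wT u uw; apply/eqP; rewrite -submx0.
apply: (cyc_ind (P := fun u => (u *m T <= (0 : 'M_m))%MS)) uw.
- exact: linpred_mul.
- by rewrite wT sub0mx.
- by move=> i v _; rewrite -mulmxA ET mulmxA !submx0 => /eqP->; rewrite mul0mx.
Qed.

End Cyclic.

(** * Comparing two filtered subspaces through their graded pieces *)

Section Filtration.
Variables (Fil pi : nat -> 'M[K]_m) (M Y : 'M[K]_m) (top : nat).
Hypothesis Fil_ker : forall d, (Fil d :&: kermx (pi d) :=: Fil d.+1)%MS.
Hypothesis Fil_top : Fil top = 0.
Hypothesis MY : forall d, ((M :&: Fil d)%MS *m pi d <= (Y :&: Fil d)%MS *m pi d)%MS.

(** Rank-nullity for [pi d], whose kernel on [Fil d] is the next step of the filtration. *)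
Lemma rank_filE (A : 'M[K]_m) d :
  (\rank ((A :&: Fil d)%MS *m pi d) + \rank (A :&: Fil d.+1)%MS = \rank (A :&: Fil d)%MS)%N.
Proof.
rewrite -[RHS](mxrank_mul_ker _ (pi d)); congr (_ + _)%N.
by apply/eqP; rewrite eqn_leq !mxrankS // -?capmxA capmxS // Fil_ker.
Qed.

(** Descending induction on [d]: graded pieces of [M] lie in those of [Y], and the filtration
    vanishes from [top] on. *)
Lemma rank_fil_le d : (\rank (M :&: Fil d)%MS <= \rank (Y :&: Fil d)%MS)%N.
Proof.
have [j] := ubnP (top - d); elim: j d => // j IH d dj.
have [td|dt] := leqP top d; last first.
  rewrite -(rank_filE M d) -(rank_filE Y d) leq_add //; [exact: mxrankS|apply: IH; lia].
rewrite (_ : Fil d = 0); first by rewrite !capmx0 !mxrank0.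
have -> : d = (top + (d - top))%N by lia.
elim: (d - top)%N => [|i IHi]; first by rewrite addn0.
apply/eqP; rewrite addnS -submx0 -(Fil_ker (top + i)) IHi.
exact: capmxSl.
Qed.

Hypothesis YM : (\rank (Y :&: Fil 0)%MS <= \rank (M :&: Fil 0)%MS)%N.

(** Once [M] is at least as large as [Y], no inclusion of graded pieces can be strict: [rank_fil_le]
    bounds the remaining degrees the other way. *)
Lemma fil_eq d : ((Y :&: Fil d)%MS *m pi d <= (M :&: Fil d)%MS *m pi d)%MS.
Proof.
have YMd : (\rank (Y :&: Fil d)%MS <= \rank (M :&: Fil d)%MS)%N.
  elim: d => // d; rewrite -(rank_filE M d) -(rank_filE Y d).
  by have := rank_fil_le d.+1; have := mxrankS (MY d); lia.
have := mxrank_leqif_sup (MY d) => /leqifP; case: ifP => // _.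
by have := rank_filE M d; have := rank_filE Y d; have := rank_fil_le d.+1; lia.
Qed.

End Filtration.

End Subspaces.

(** * Gradings of a coordinate space and homogeneous operators *)

Section Weights.
Variables (K : fieldType) (m : nat).
Implicit Types (u v w : 'rV[K]_m) (A : 'M[K]_m).

Definition pj (P : pred 'I_m) : 'M[K]_m := diag_mx (\row_s (P s)%:R).

Lemma pjE u P s : (u *m pj P) 0 s = u 0 s * (P s)%:R.
Proof. by rewrite mul_mx_diag !mxE. Qed.

Lemma sub_pj u P : (u <= pj P)%MS <-> forall s, u 0 s != 0 -> P s.
Proof.
split=> [/submxP[r ->] s|uP].
  by rewrite pjE; case: (P s); rewrite // mulr0 eqxx.
suff <- : u *m pj P = u by exact: submxMl.
apply/rowP => s; rewrite pjE.
have := uP s; case: (P s); rewrite ?mulr1 // mulr0.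
by case: eqP => // _ /(_ isT).
Qed.

Variable wt : 'I_m -> nat.

(** The lowest-energy part of a vector of [fil d] is its image under [gr d]. *)
Definition fil d := pj (fun s => (d <= wt s)%N).
Definition gr d := pj (fun s => wt s == d).

Lemma fil_ker d : (fil d :&: kermx (gr d) :=: fil d.+1)%MS.
Proof.
apply/eqmxP/andP; split; apply/row_subP => r.
  move: (row_sub r (fil d :&: kermx (gr d))%MS); rewrite sub_capmx.
  move: (row _ _) => u /andP[/sub_pj uf /sub_kermxP ug]; apply/sub_pj => s us.
  rewrite ltn_neqAle uf // andbT eq_sym; apply: contraNN us => sd.
  by have := pjE u (fun s => wt s == d) s; rewrite -/(gr d) ug sd mulr1 => <-; rewrite mxE.
move: (row_sub r (fil d.+1)); move: (row _ _) => u /sub_pj uf; rewrite sub_capmx; apply/andP; split.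
  by apply/sub_pj => s /uf; exact: ltnW.
apply/sub_kermxP/rowP => s; rewrite pjE mxE.
case: (u 0 s =P 0) => [->|/eqP/uf]; first by rewrite mul0r.
by case: eqP; rewrite ?mulr0 //; lia.
Qed.

(** [A] is homogeneous of degree [h]. *)
Definition raises h A := forall s t, A s t != 0 -> wt t = (wt s + h)%N.

Lemma raises_sum (I : Type) (r : seq I) (P : pred I) (F : I -> 'M[K]_m) h :
  (forall i, P i -> raises h (F i)) -> raises h (\sum_(i <- r | P i) F i).
Proof.
move=> hF s t; rewrite summxE => nz; apply: contrapT => nh; case/eqP: nz.
rewrite big1 // => i Pi; apply/eqP; apply/negPn/negP => /(hF i Pi); exact: nh.
Qed.

Lemma raisesZ c A h : raises h A -> raises h (c *: A).
Proof. by move=> hA s t; rewrite mxE => nz; apply: hA; apply: contraNN nz => /eqP->; rewrite mulr0. Qed.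

Lemma raisesM h1 h2 A1 A2 : raises h1 A1 -> raises h2 A2 -> raises (h1 + h2) (A1 *m A2).
Proof.
move=> hA1 hA2 s t; rewrite mxE => nz.
have [r] : exists r, A1 s r * A2 r t != 0.
  apply: contrapT => nr; case/eqP: nz; rewrite big1 // => r _.
  by apply/eqP; apply/negPn/negP => nz; apply: nr; exists r.
rewrite mulf_eq0 negb_or => /andP[/hA1 e1 /hA2 ->]; rewrite e1; lia.
Qed.

Lemma raises_fil h A u d : raises h A -> (u <= fil d)%MS -> (u *m A <= fil (d + h)%N)%MS.
Proof.
move=> hA /sub_pj ud; apply/sub_pj => t; rewrite mxE => nz.
have [s] : exists s, u 0 s * A s t != 0.
  apply: contrapT => nr; case/eqP: nz; rewrite big1 // => r _.
  by apply/eqP; apply/negPn/negP => nz; apply: nr; exists r.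
rewrite mulf_eq0 negb_or => /andP[/ud us /hA ->]; lia.
Qed.

Lemma raises_gr h A d : raises h A -> A *m gr (d + h)%N = gr d *m A.
Proof.
move=> hA; apply/matrixP => s t; rewrite mul_mx_diag mul_diag_mx !mxE.
have [->|/eqP/eqP nz] := eqVneq (A s t) 0; first by rewrite mul0r mulr0.
by rewrite (hA s t) // mulrC eqn_add2r.
Qed.

Lemma raises_gr_lt h A d : raises h A -> (d < h)%N -> A *m gr d = 0.
Proof.
move=> hA dh; apply/matrixP => s t; rewrite mul_mx_diag !mxE.
have [->|nz] := eqVneq (A s t) 0; first by rewrite mul0r.
by rewrite (hA s t) // (_ : _ == d = false) ?mulr0 //; apply/eqP; lia.
Qed.

Lemma fil_le u d d' : (d' <= d)%N -> (u <= fil d)%MS -> (u <= fil d')%MS.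
Proof. by move=> dd /sub_pj ud; apply/sub_pj => s /ud; exact: leq_trans. Qed.

Lemma fil_gr_lt u d d' : (d < d')%N -> (u <= fil d')%MS -> u *m gr d = 0.
Proof.
move=> dd /sub_pj ud; apply/rowP => s; rewrite pjE mxE.
case: (u 0 s =P 0) => [->|/eqP/ud]; first by rewrite mul0r.
by case: eqP; rewrite ?mulr0 //; lia.
Qed.

Lemma fil0 : fil 0 = 1%:M.
Proof. by apply/matrixP => s t; rewrite !mxE leq0n. Qed.

Lemma fil_top : fil (\max_s wt s).+1 = 0.
Proof.
apply/matrixP => s t; rewrite !mxE leqNgt ltnS leq_bigmax /= mul0rn.
by [].
Qed.

End Weights.

(** * Powers of sums of commuting square-zero elements *)

Section SquareZero.
Variable R : pzRingType.

Lemma sq0_exprD (t s : R) n : GRing.comm t s -> t * t = 0 ->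
  (t + s) ^+ n.+1 = s ^+ n.+1 + (t * s ^+ n) *+ n.+1.
Proof.
move=> cts t0; elim: n => [|n IH]; first by rewrite !expr1 expr0 mulr1 mulr1n addrC.
rewrite exprS {}IH mulrDl !mulrDr mulrnAr mulrA t0 mul0r mul0rn addr0.
rewrite -exprS mulrnAr (mulrA s t) -cts -(mulrA t s) -exprS addrCA addrA.
by rewrite -addrA -mulrS addrC addrC.
Qed.

Variables (I : eqType) (t : I -> R).
Hypothesis t_comm : forall i j, GRing.comm (t i) (t j).
Hypothesis t_sq0 : forall i, t i * t i = 0.

(** Multinomial expansion: a repeated factor kills a term, so the top power retains only the product
    of all factors, once for each order. *)
Lemma sq0_sum_exp (r : seq I) :
  (\sum_(i <- r) t i) ^+ size r = (\prod_(i <- r) t i) *+ (size r)`! /\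
  (\sum_(i <- r) t i) ^+ (size r).+1 = 0.
Proof.
elim: r => [|i r [IH1 IH2]]; first by rewrite !big_nil expr0 expr1.
have cr : GRing.comm (t i) (\sum_(j <- r) t j).
  by apply: commr_sum => j _.
rewrite !big_cons /= !sq0_exprD // IH2 add0r IH1 exprSr IH2 mul0r mulr0 mul0rn addr0.
by rewrite mulrnAr -mulrnA factS mulnC.
Qed.

End SquareZero.

(* The coefficients are [1 / prod (z - z')], from Lagrange interpolation at the
   nodes [z]. *)
Lemma lagrange_weights (K : fieldType) (I : finType) (D : pred I) (z : I -> K) :
  {in D &, injective z} ->
  exists c : I -> K,
    [/\ forall l, l \notin D -> c l = 0, forall l, l \in D -> c l != 0 &
        forall n, (n < #|D|)%N -> \sum_l c l * z l ^+ n = (n.+1 == #|D|)%:R].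
Proof.
move=> zinj.
pose q l : {poly K} := \prod_(i <- enum [predD1 D & l]) ('X - (z i)%:P).
pose c l : K := if l \in D then (q l).[z l]^-1 else 0.
have qE l i : l \in D -> i \in D -> i != l -> (q l).[z i] = 0.
  move=> lD iD il; apply/eqP; rewrite horner_prod prodf_seq_eq0; apply/hasP.
  by exists i; rewrite ?mem_enum ?inE ?il //= hornerXsubC subrr.
have qz l : l \in D -> (q l).[z l] != 0.
  move=> lD; rewrite horner_prod prodf_seq_neq0; apply/allP => i.
  rewrite mem_enum !inE hornerXsubC subr_eq0 => /andP[il iD].
  by apply: contraNneq il => /zinj->.
have qm l : q l \is monic by exact: monic_prod_XsubC.
have qs l : l \in D -> size (q l) = #|D|.
  by move=> lD; rewrite size_prod_XsubC -cardE [in RHS](cardD1 l) lD.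
exists c; split=> [l lD|l lD|n nD].
- by rewrite /c (negPf lD).
- by rewrite /c lD invr_eq0 qz.
(* The interpolation of ['X^n] minus ['X^n] has degree below the number of nodes and vanishes at
   each of them; its coefficient of degree [#|D|.-1] yields the claim. *)
pose p : {poly K} := \sum_(l in D) (c l * z l ^+ n) *: q l - 'X^n.
have p0 : p = 0.
  apply/eqP; apply: contraTT (leqnn #|D|) => pn0; rewrite -ltnNge.
  have := max_poly_roots pn0 (rs := map z (enum D)).
  rewrite size_map -cardE => /(_ _ _)/leq_trans; apply.
  - apply/allP => _ /mapP[i + ->]; rewrite mem_enum => iD; apply/rootP.
    rewrite hornerD hornerN hornerXn horner_sum (bigD1 i) //= hornerZ big1 => [|l /andP[lD li]].
      by rewrite addr0 /c iD mulrAC mulVf ?qz // mul1r subrr.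
    by rewrite hornerZ qE ?mulr0 // eq_sym.
  - by rewrite map_inj_in_uniq ?enum_uniq // => i j; rewrite !mem_enum; exact: zinj.
  - rewrite (leq_trans (size_polyD _ _)) // geq_max size_polyN size_polyXn nD andbT.
    apply: (leq_trans (size_sum _ _ _)); apply/bigmax_leqP => l lD.
    by rewrite (leq_trans (size_scale_leq _ _)) // qs.
have := congr1 (fun p : {poly K} => p`_#|D|.-1) p0.
rewrite coefD coefN coefXn coef0 coef_sum => /eqP; rewrite subr_eq0 => /eqP pE.
rewrite (bigID [in D]) /= [X in _ + X]big1 ?addr0 => [|l lD]; last by rewrite /c (negPf lD) mul0r.
have <- : (#|D|.-1 == n) = (n.+1 == #|D|) by case: #|D| nD => // d _; rewrite eqSS eq_sym.
rewrite -pE; apply: eq_bigr => l lD; rewrite coefZ -{1}(qs l lD) -/(lead_coef _) (monicP (qm l)).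
by rewrite mulr1.
Qed.

(** * The truncated Fock space *)

(** Monomials with exponents at most [n i] span; the operators are adjoined one at a time, each
    multiplying the bound by [(n i).+1]. *)
Lemma cyc_rank (K : fieldType) (m : nat) (I : finType) (y : I -> 'M[K]_m) (n : I -> nat) w :
    (forall i j, GRing.comm (y i) (y j)) -> (forall i, y i ^+ (n i).+1 = 0) ->
  (\rank (cyc y w) <= \prod_i (n i).+1)%N.
Proof.
move=> ycomm ynil.
have [A [rA wA stA]] : exists A : 'M[K]_m, [/\ (\rank A <= \prod_(i <- enum I) (n i).+1)%N,
    (w <= A)%MS & forall i, i \in enum I -> (A *m y i <= A)%MS].
  elim: (enum I) => [|i r [A [rA wA stA]]].
    (* The line through [w] as a square matrix with all rows equal to [w]; the case [m = 0] is
       separate, there being no row to pick. *)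
    exists (\matrix_(_ < m) w); split=> //; last first.
      apply/submxP; case: m y w {ynil ycomm} => [|m'] y w; first by exists 0; apply/rowP => -[].
      exists (delta_mx 0 0); apply/rowP => j; rewrite !mxE (bigD1 0) //= !mxE !eqxx mul1r.
      by rewrite big1 ?addr0 // => l; rewrite !mxE => /negPf->; rewrite mul0r.
    rewrite big_nil (leq_trans _ (rank_leq_row w)) //; apply: mxrankS.
    by apply/row_subP => l; rewrite rowK.
  exists (\sum_(l < (n i).+1) A *m y i ^+ l)%MS; split.
  - rewrite big_cons (leq_trans (mxrank_sum_leqif _)) //=.
    apply: (@leq_trans (\sum_(l < (n i).+1) \prod_(j <- r) (n j).+1)%N).
      by apply: leq_sum => l _; rewrite (leq_trans (mxrankM_maxl _ _)).
    by rewrite sum_nat_const card_ord.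
  - by apply: (sumsmx_sup 0) => //; rewrite expr0 [A *m 1](mulmx1 A).
  - move=> j; rewrite inE => /predU1P[->|jr]; rewrite sumsmxMr; apply/sumsmx_subP => l _.
      rewrite -mulmxA [y i ^+ l *m y i](_ : _ = y i ^+ l.+1); last by rewrite exprSr.
      have [ln|nl] := ltnP l.+1 (n i).+1; first by apply: (sumsmx_sup (Ordinal ln)).
      have -> : l.+1 = (n i).+1 by have := ltn_ord l; lia.
      by rewrite ynil mulmx0 sub0mx.
    rewrite -mulmxA [y i ^+ l *m y j](_ : _ = y j *m y i ^+ l); last first.
      by apply: commr_sym; apply: commrX.
    by rewrite mulmxA; apply: (sumsmx_sup l) => //; apply: submxMr; exact: stA.
rewrite big_enum /= in rA; rewrite (leq_trans _ rA) //; apply: mxrankS.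
apply: cyc_sub => // i u uA; apply: submx_trans (submxMr _ uA) (stA i _).
by rewrite mem_enum.
Qed.

(** * Fermions on finitely many positions, and the modes as quadratic operators *)

Section Model.
Variables (K : numFieldType) (k N' B : nat).
Local Notation N := N'.+1.

Definition site := ('I_k * 'I_N)%type.
(** Component by component, so that the factors of one component stay together as in a tensor
    product. *)
Definition srk (j : site) : nat := (j.1 * N + j.2)%N.

Lemma srk_inj : injective srk.
Proof.
move=> [a x] [b y]; rewrite /srk /= => e.
have ab : a = b :> nat.
  by have := congr1 (divn^~ N) e; rewrite !divnMDl // !divn_small // !addn0.
by move: e; rewrite ab => /addnI/val_inj->; rewrite (val_inj ab).
Qed.

Local Notation fkdim := (fdim site).
Implicit Types (u v w : 'rV[K]_fkdim) (f : 'I_k -> nat).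

Definition creation (a : 'I_k) (x : 'I_N) : 'M[K]_fkdim := cre K srk (a, x).
Definition annihilation (a : 'I_k) (x : 'I_N) : 'M[K]_fkdim := ann K srk (a, x).

Lemma psi_anti a x b y : creation a x *m creation b y = - (creation b y *m creation a x).
Proof. exact: cre_anti srk_inj _ _. Qed.

Lemma psi_sq a x : creation a x *m creation a x = 0.
Proof. exact: cre_sq. Qed.

Lemma del_psi a x b y :
  annihilation a x *m creation b y = ((a, x) == (b, y))%:R%:M - creation b y *m annihilation a x.
Proof. by rewrite -(ann_cre K srk_inj) addrK. Qed.

(** The energy up to a constant per factor: for even [B] the mode at [x] has [d]-degree
    [uphalf x - B / 2]. The shift makes energies natural numbers. *)
Definition en (s : 'I_fkdim) : nat := (\sum_(j in stt s) uphalf j.2)%N.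

Lemma psi_raises a (x : 'I_N) : raises en (uphalf x) (creation a x).
Proof.
move=> s t; rewrite mxE; case: ifP => [_|jS]; first by rewrite mxE eqxx.
rewrite !mxE eqxx /=; case: (t =P _) => [->|_]; last by rewrite mulr0 eqxx.
by rewrite /en rnkK big_setU1 ?jS //= addnC.
Qed.

(** A good triple [(a, x, y)] stands for the product of psi at [y] and phi at [x] in component [a];
    [ht] tells which mode contains it. *)
Definition triple := ('I_k * 'I_N * 'I_N)%type.
Definition good (t : triple) := ~~ odd t.1.2 && odd t.2.
Definition ht (t : triple) : nat := (t.1.2./2 + t.2./2).+1.
Definition pair_op (t : triple) := creation t.1.1 t.2 *m creation t.1.1 t.1.2.
(** For a good triple, the condition that its pair does not annihilate the vacuum of filling [f]. *)
Definition fresh f (t : triple) := (f t.1.1 <= t.1.2)%N && (f t.1.1 <= t.2)%N.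

Lemma pr_psi t a x : pair_op t *m creation a x = creation a x *m pair_op t.
Proof. by rewrite /pair_op -mulmxA (psi_anti _ _ a x) mulmxN !mulmxA (psi_anti _ _ a x) mulNmx opprK. Qed.

Lemma pr_comm t t' : pair_op t *m pair_op t' = pair_op t' *m pair_op t.
Proof. by rewrite [pair_op t']/pair_op mulmxA pr_psi -mulmxA pr_psi mulmxA. Qed.

Lemma pr_raises t : good t -> raises en (ht t) (pair_op t).
Proof.
move=> /andP[ex oy]; rewrite /ht (_ : (_ + _).+1 = uphalf t.2 + uphalf t.1.2)%N; last first.
  by rewrite !uphalf_half (negPf ex) oy; lia.
by apply: raisesM; exact: psi_raises.
Qed.

(** The modes and their deformations all have this form; quadratic in the creation operators, they
    commute with one another. *)
Definition quad_op (c : triple -> K) := \sum_(t | good t) c t *: pair_op t.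

Lemma oper_psi c a x : quad_op c *m creation a x = creation a x *m quad_op c.
Proof.
rewrite /quad_op mulmx_suml mulmx_sumr; apply: eq_bigr => t _.
by rewrite -scalemxAl -scalemxAr pr_psi.
Qed.

Lemma oper_pr c t : quad_op c *m pair_op t = pair_op t *m quad_op c.
Proof. by rewrite /pair_op mulmxA oper_psi -mulmxA oper_psi mulmxA. Qed.

Lemma oper_comm c c' : quad_op c *m quad_op c' = quad_op c' *m quad_op c.
Proof.
rewrite [quad_op c']/quad_op mulmx_suml mulmx_sumr; apply: eq_bigr => t _.
by rewrite -scalemxAl -scalemxAr oper_pr.
Qed.

Lemma oper_sum (I : finType) (P : pred I) (F : I -> triple -> K) :
  quad_op (fun t => \sum_(i | P i) F i t) = \sum_(i | P i) quad_op (F i).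
Proof. by rewrite exchange_big /=; apply: eq_bigr => t _; rewrite scaler_suml. Qed.

Lemma operZ z c : quad_op (fun t => z * c t) = z *: quad_op c.
Proof. by rewrite /quad_op scaler_sumr; apply: eq_bigr => t _; rewrite scalerA. Qed.

Lemma eq_oper c c' : (forall t, good t -> c t = c' t) -> quad_op c = quad_op c'.
Proof. by move=> cc; apply: eq_bigr => t gt; rewrite cc. Qed.

(* [mode n] is e_(n - B): the position [x] is the position [x + 1 - B] of [Defs], so that,
   [B] being even, phi sits at even [x] and psi at odd [x]. *)
Definition mode n := quad_op (fun t => (ht t == n)%:R).
Definition mode_fam (i : 'I_B) := mode i.+1.

Lemma oper_raises c n : (forall t, good t -> ht t != n -> c t = 0) -> raises en n (quad_op c).
Proof.
move=> c0; rewrite /quad_op; apply: raises_sum => t gt.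
have [<-|tn] := eqVneq (ht t) n; first by apply: raisesZ; exact: pr_raises.
by move=> s s'; rewrite c0 // scale0r mxE eqxx.
Qed.

(** Pairs of height above [n] raise the filtration further and vanish in degree [d + n]; only height
    exactly [n] reaches the lowest part. *)
Lemma oper_lead c n u d : (forall t, good t -> (ht t < n)%N -> c t = 0) ->
    (u <= fil K en d)%MS ->
  (u *m quad_op c <= fil K en (d + n)%N)%MS /\
  u *m quad_op c *m gr K en (d + n)%N = u *m gr K en d *m quad_op (fun t => (ht t == n)%:R * c t).
Proof.
move=> c0 ud; rewrite /quad_op !mulmx_sumr mulmx_suml; split.
  apply: summx_sub => t gt; have [tn|nt] := ltnP (ht t) n.
    by rewrite c0 // scale0r mulmx0 sub0mx.
  rewrite -scalemxAr scalemx_sub // (fil_le (d := (d + ht t)%N)) ?leq_add2l //.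
  exact: raises_fil (pr_raises gt) ud.
apply: eq_bigr => t gt; rewrite -!scalemxAr -scalemxAl.
have [tn|nt|tn] := ltngtP (ht t) n; last first.
- by rewrite mul1r -tn -mulmxA (raises_gr d (pr_raises gt)) mulmxA.
- rewrite mul0r scale0r (fil_gr_lt (d' := (d + ht t)%N)) ?scaler0 ?ltn_add2l //.
  exact: raises_fil (pr_raises gt) ud.
- by rewrite c0 // mul0r !scale0r.
Qed.

(* [f a] is the number of filled positions of the component [a], which is thus the
   vacuum v(f a - B). *)
Definition ket_fill f := ket K [set j : site | (j.2 < f j.1)%N].

(** Signs accumulate when modes act on vacua, so vacua are handled up to a nonzero scalar. *)
Definition vacuum f w := exists2 c, c != 0 & w = c *: ket_fill f.

Lemma vac_ketf f : vacuum f (ket_fill f).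
Proof. by exists 1; rewrite ?oner_eq0 ?scale1r. Qed.

Lemma vac_neq0 f w : vacuum f w -> w != 0.
Proof. by case=> c c0 ->; rewrite scaler_eq0 negb_or c0 ket_neq0. Qed.

Lemma vac_psi f w a (x : 'I_N) : vacuum f w -> (x < f a)%N -> w *m creation a x = 0.
Proof. by case=> c _ -> xf; rewrite -scalemxAl ket_cre inE xf scaler0. Qed.

Lemma vac_del f w a (x : 'I_N) : vacuum f w -> (f a <= x)%N -> w *m annihilation a x = 0.
Proof. by case=> c _ -> xf; rewrite -scalemxAl ket_ann inE ltnNge xf scaler0. Qed.

Lemma vac_ext f g w : f =1 g -> vacuum f w -> vacuum g w.
Proof.
move=> fg [c c0 ->]; exists c => //; congr (_ *: ket _ _).
by apply/setP => j; rewrite !inE fg.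
Qed.

Lemma vac_scale f w c : c != 0 -> vacuum f w -> vacuum f (c *: w).
Proof. by move=> c0 [d d0 ->]; exists (c * d); rewrite ?mulf_neq0 ?scalerA. Qed.

Lemma vac_up f g w a (x : 'I_N) : vacuum f w -> f a = x ->
  (forall b, g b = f b + (b == a))%N -> vacuum g (w *m creation a x).
Proof.
case=> c c0 -> fa gE; rewrite -scalemxAl ket_cre inE fa ltnn scalerA.
exists (c * fsign K srk (a, x) [set j : site | (j.2 < f j.1)%N]); first by rewrite mulf_neq0 ?sg_neq0.
congr (_ *: ket _ _); apply/setP => -[b y]; rewrite !inE /= gE xpair_eqE.
case: eqP => [->|_] /=; last by rewrite addn0.
by rewrite fa addn1 ltnS [RHS]leq_eqVlt.
Qed.

Lemma vac_down f g w a (x : 'I_N) : vacuum f w -> f a = x.+1 ->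
  (forall b, g b = f b - (b == a))%N -> vacuum g (w *m annihilation a x).
Proof.
case=> c c0 -> fa gE; rewrite -scalemxAl ket_ann inE fa ltnS leqnn scalerA.
exists (c * fsign K srk (a, x) [set j : site | (j.2 < f j.1)%N]); first by rewrite mulf_neq0 ?sg_neq0.
congr (_ *: ket _ _); apply/setP => -[b y]; rewrite !inE /= gE xpair_eqE.
case: eqP => [->|_] /=; last by rewrite subn0.
by rewrite fa subn1 /= ltnS [RHS]ltn_neqAle.
Qed.

End Model.

(** * Upper bound for the dimension *)

Section Upper.
Variables (K : numFieldType) (k N' B : nat).
Local Notation N := N'.+1.
Local Notation fkdim := (fdim (site k N')).
Local Notation Emode := (mode K k N').
Local Notation Efam := (@mode_fam K k N' B).
Local Notation en := (@en k N').
Local Notation gr := (gr K en).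
Local Notation fil := (fil K en).
Local Notation crea := (@creation K k N').
Local Notation pairop := (@pair_op K k N').
Local Notation oper := (@quad_op K k N').
Local Notation triple := (triple k N').

Definition lcomb a (al : 'I_N -> K) : 'M[K]_fkdim := \sum_x al x *: crea a x.

Lemma lcomb_anti a al b be :
  lcomb a al *m lcomb b be = - (lcomb b be *m lcomb a al).
Proof.
rewrite /lcomb !mulmx_suml; under eq_bigr do rewrite mulmx_sumr.
rewrite exchange_big /= -sumrN; apply: eq_bigr => y _; rewrite mulmx_sumr -sumrN.
apply: eq_bigr => x _; rewrite -!scalemxAl -!scalemxAr psi_anti !scalerN !scalerA.
by rewrite mulrC.
Qed.

Lemma lcomb_sq a al : lcomb a al *m lcomb a al = 0.
Proof.
apply/eqP; have /eqP := lcomb_anti a al a al; rewrite -subr_eq0 opprK -mulr2n.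
by rewrite -scaler_nat scaler_eq0 pnatr_eq0.
Qed.

Lemma lcomb_even a al be b ga :
  lcomb a al *m lcomb a be *m lcomb b ga = lcomb b ga *m (lcomb a al *m lcomb a be).
Proof.
by rewrite -mulmxA (lcomb_anti a be) mulmxN !mulmxA (lcomb_anti a al) mulNmx opprK.
Qed.

Lemma lcomb_comm a al be b al' be' :
  lcomb a al *m lcomb a be *m (lcomb b al' *m lcomb b be') =
  lcomb b al' *m lcomb b be' *m (lcomb a al *m lcomb a be).
Proof. by rewrite mulmxA lcomb_even -mulmxA lcomb_even mulmxA. Qed.

Lemma lcomb_prod_sq a al be :
  lcomb a al *m lcomb a be *m (lcomb a al *m lcomb a be) = 0.
Proof.
rewrite mulmxA -(mulmxA (lcomb a al)) (lcomb_anti a be a al) mulmxN mulNmx.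
by rewrite !mulmxA lcomb_sq !mul0mx oppr0.
Qed.

Variable f : 'I_k -> nat.
Implicit Types (a b : 'I_k) (l : 'I_B) (t : triple) (u v w : 'rV[K]_fkdim).

(** The points 0, ..., [B - 1] are shared by all components; component [a] uses the [B - f a] points
    from [f a] on, so [nle l] counts the components that use [l]. *)
Definition node (l : 'I_B) : K := l%:R.
Definition nodes (a : 'I_k) : pred 'I_B := [pred l : 'I_B | (f a <= l)%N].

Lemma node_inj a : {in nodes a &, injective node}.
Proof. by move=> l l' _ _ /eqP; rewrite eqr_nat => /eqP/val_inj. Qed.

Lemma card_nodes a : #|nodes a| = (B - f a)%N.
Proof.
rewrite -sum1_card (eq_bigl (fun l : 'I_B => f a <= l)%N) //.
have -> : (\sum_(l < B | f a <= l) 1 = \sum_(f a <= l < B) 1)%N.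
  by rewrite (big_geq_mkord _ _ predT (fun=> 1%N)).
by rewrite sum_nat_const_nat muln1.
Qed.

Definition wgt a : 'I_B -> K := sval (cid (lagrange_weights (@node_inj a))).

Lemma wgt_out a l : (l < f a)%N -> wgt a l = 0.
Proof. by rewrite /wgt; case: cid => c /= [c0 _ _] lf; apply: c0; rewrite inE -ltnNge. Qed.

Lemma wgt_neq0 a l : (f a <= l)%N -> wgt a l != 0.
Proof. by rewrite /wgt; case: cid => c /= [_ c0 _] lf; apply: c0; rewrite inE. Qed.

Lemma wgt_sum a n : (n < B - f a)%N -> \sum_l wgt a l * node l ^+ n = (n.+1 == B - f a)%N%:R.
Proof. by rewrite -card_nodes /wgt; case: cid => c /= [_ _]; apply. Qed.

(** The first free even and odd positions of a component form a pair of height [(f a).+1]; any fresh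
    pair exceeds it by the sum of its two offsets. This additivity lets the generating series factor
    in [pairE]. *)
Lemma fresh_ht (t : triple) : good t -> fresh f t ->
  ht t = ((t.1.2./2 - uphalf (f t.1.1)) + (t.2./2 - (f t.1.1)./2) + (f t.1.1).+1)%N.
Proof.
case: t => [[a x] y] /andP[/= ex oy] /andP[/= fx fy]; rewrite /ht /=.
have h1 : (uphalf (f a) <= x./2)%N by move: ex fx; lia.
have h2 : ((f a)./2 <= y./2)%N by lia.
lia.
Qed.

Definition ycoef l (t : triple) : K :=
  (fresh f t)%:R * (wgt t.1.1 l * node l ^+ (ht t - (f t.1.1).+1)).
Definition yop l := oper (ycoef l).

(** Generating series of the free phi, respectively psi, modes of component [a] at the node [l],
    with exponents counted from the first free position. *)
Definition phiL a l := lcomb a (fun x => (~~ odd x && (f a <= x)%N)%:R * node l ^+ (x./2 - uphalf (f a))).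
Definition psiL a l := lcomb a (fun y => (odd y && (f a <= y)%N)%:R * node l ^+ (y./2 - (f a)./2)).

Lemma triple_sum (V : nmodType) (F : triple -> V) :
  \sum_t F t = \sum_a \sum_x \sum_y F (a, x, y).
Proof.
rewrite (pair_bigA _ (fun a x => \sum_y F (a, x, y))) /=.
rewrite (pair_bigA _ (fun p y => F (p.1, p.2, y))) /=.
by apply: eq_bigr => -[[a x] y].
Qed.

Lemma pairE a l : psiL a l *m phiL a l =
  oper (fun t => (t.1.1 == a)%:R * ((fresh f t)%:R * node l ^+ (ht t - (f t.1.1).+1))).
Proof.
rewrite /oper [RHS]big_mkcond /= triple_sum (bigD1 a) //= [X in _ + X]big1 ?addr0; last first.
  move=> b /negPf ba; rewrite big1 // => x _; rewrite big1 // => y _.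
  by rewrite ba mul0r scale0r if_same.
rewrite /psiL /phiL /lcomb mulmx_sumr; apply: eq_bigr => x _.
rewrite mulmx_suml; apply: eq_bigr => y _.
rewrite -scalemxAl -scalemxAr !scalerA eqxx mul1r.
have [gt|ngt] := boolP (good (a, x, y)); last first.
  by move: ngt; rewrite /good /=; case: (odd x); case: (odd y); rewrite //= ?(mul0r, mulr0) ?(mul0r, mulr0) ?scale0r.
have [ft|nft] := boolP (fresh f (a, x, y)); last first.
  move: nft gt; rewrite /fresh /good /= => nft /andP[-> ->] /=; rewrite mul0r scale0r.
  by case: (f a <= x)%N nft; case: (f a <= y)%N; rewrite //= ?(mul0r, mulr0) ?(mul0r, mulr0) ?scale0r.
rewrite (fresh_ht gt ft) addnK exprD /=; move: ft gt.
by rewrite /fresh /good /= => /andP[-> ->] /andP[-> ->]; rewrite !mul1r mulrC.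
Qed.

(** One summand per component having [l] among its nodes. Each is a product of two anticommuting
    square-zero elements, hence squares to zero, which bounds the nilpotency order of [yop l]. *)
Lemma yopE l : yop l = \sum_(a | (f a <= l)%N) wgt a l *: (psiL a l *m phiL a l).
Proof.
under eq_bigr do rewrite pairE -operZ; rewrite -oper_sum; apply: eq_oper => t _.
rewrite /ycoef; have [fl|lf] := leqP (f t.1.1) l.
  rewrite (bigD1 t.1.1) //= big1 => [|b /andP[_ /negPf ba]]; last by rewrite eq_sym ba mul0r mulr0.
  by rewrite addr0 eqxx mul1r mulrCA.
rewrite wgt_out // mul0r mulr0 big1 // => b bl; case: eqP => [e|_]; last by rewrite mul0r mulr0.
by rewrite -e leqNgt lf in bl.
Qed.

Lemma yop_comm l l' : GRing.comm (yop l) (yop l').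
Proof. exact: oper_comm. Qed.

Definition nle (l : nat) : nat := #|[pred a | (f a <= l)%N]|.

Lemma yop_expE (l : 'I_B) :
  yop l ^+ nle l = (\prod_(a <- enum [pred a | (f a <= l)%N]) (wgt a l *: (psiL a l *m phiL a l))) *+ (nle l)`!
  /\ yop l ^+ (nle l).+1 = 0.
Proof.
rewrite yopE -big_enum /nle cardE; apply: sq0_sum_exp => [a b|a].
  rewrite /GRing.comm; change (wgt a l *: (psiL a l *m phiL a l) *m (wgt b l *: (psiL b l *m phiL b l)) =
    wgt b l *: (psiL b l *m phiL b l) *m (wgt a l *: (psiL a l *m phiL a l))).
  rewrite -!scalemxAl -!scalemxAr !scalerA mulrC; congr (_ *: _); exact: lcomb_comm.
change (wgt a l *: (psiL a l *m phiL a l) *m (wgt a l *: (psiL a l *m phiL a l)) = 0).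
by rewrite -scalemxAl -scalemxAr lcomb_prod_sq !scaler0.
Qed.

Definition Pdim := (\prod_(l < B) (nle l).+1)%N.

Definition Y w := cyc yop w.

Lemma rank_Y w : (\rank (Y w) <= Pdim)%N.
Proof. by apply: cyc_rank => [l l'|l]; [exact: yop_comm|case: (yop_expE l)]. Qed.

(* Deforms [Emode n] by terms of higher energy. *)
Definition Edef n := \sum_l node l ^+ (B - n) *: yop l.

(** The part of [mode n] that survives on the vacuum; the two agree on the whole module by
    [M_Efr]. *)
Definition Efr n := oper (fun t => (fresh f t && (ht t == n))%:R).

Lemma EdefE n : Edef n =
  oper (fun t => (fresh f t)%:R * \sum_l wgt t.1.1 l * node l ^+ (B - n + (ht t - (f t.1.1).+1))).
Proof.
rewrite /Edef; under eq_bigr do rewrite -operZ.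
rewrite -oper_sum; apply: eq_oper => t _; rewrite mulr_sumr; apply: eq_bigr => l _.
by rewrite /ycoef exprD mulrCA; congr (_ * _); rewrite mulrCA.
Qed.

(** For a fresh pair of height at most [n] the exponent is at most [B - f a - 1], where the
    interpolation sums are 1 at the top exponent, reached for height [n], and 0 below. *)
Lemma Edef_coef n (t : triple) : (0 < n <= B)%N -> good t -> (ht t <= n)%N ->
  (fresh f t)%:R * (\sum_l wgt t.1.1 l * node l ^+ (B - n + (ht t - (f t.1.1).+1))) =
  (fresh f t && (ht t == n))%:R.
Proof.
move=> nB gt tn; have [ft|_] := boolP (fresh f t); last by rewrite mul0r.
have := fresh_ht gt ft; set h := ht t in tn *; move=> hE.
rewrite mul1r wgt_sum; last by lia.
by congr (_ %:R); apply/eqP; case: eqP; case: eqP; lia.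
Qed.

Lemma Edef_lead n u d : (0 < n <= B)%N -> (u <= fil d)%MS ->
  (u *m Edef n <= fil (d + n)%N)%MS /\
  u *m Edef n *m gr (d + n)%N = u *m gr d *m Efr n.
Proof.
move=> nB ud; rewrite EdefE.
have c0 t : good t -> (ht t < n)%N -> (fresh f t)%:R * 
    (\sum_l wgt t.1.1 l * node l ^+ (B - n + (ht t - (f t.1.1).+1))) = 0.
  by move=> gt tn; rewrite Edef_coef ?(ltnW tn) // (ltn_eqF tn) andbF.
have [H1 ->] := oper_lead c0 ud; split=> //; congr (_ *m _); apply: eq_oper => t gt.
have [tn|_] := eqVneq (ht t) n; last by rewrite mul0r andbF.
by rewrite mul1r Edef_coef ?tn // eqxx.
Qed.

Lemma Y_Edef w n u : (u <= Y w)%MS -> (u *m Edef n <= Y w)%MS.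
Proof.
move=> uY; rewrite /Edef mulmx_sumr; apply: summx_sub => l _.
by rewrite -scalemxAr scalemx_sub // cyc_stable.
Qed.

Definition Mcyc w := cyc Efam w.

Lemma E_raises n : raises en n (Emode n).
Proof. by apply: oper_raises => t _ /negPf->. Qed.

Lemma fresh_kill w c c' : vacuum f w -> (forall t, good t -> fresh f t -> c t = c' t) ->
  w *m oper c = w *m oper c'.
Proof.
move=> vw cc; rewrite /oper !mulmx_sumr; apply: eq_bigr => t gt.
have [ft|] := boolP (fresh f t); first by rewrite cc.
rewrite negb_and -!ltnNge -!scalemxAr /pairop => /orP[tf|tf]; rewrite mulmxA.
  rewrite -mulmxA psi_anti mulmxN mulmxA.
  by rewrite (vac_psi vw tf) mul0mx oppr0 !scaler0.
by rewrite (vac_psi vw tf) mul0mx !scaler0.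
Qed.

Lemma M_Efr w n u : vacuum f w -> (u <= Mcyc w)%MS -> u *m Emode n = u *m Efr n.
Proof.
move=> vw uM; apply/eqP; rewrite -subr_eq0 -mulmxBr; apply/eqP.
apply: (cyc_kill _ _ uM) => [i|].
  by rewrite mulmxBr mulmxBl; congr (_ - _); exact: oper_comm.
rewrite mulmxBr; apply/eqP; rewrite subr_eq0; apply/eqP; apply: fresh_kill => // t _ ->.
by [].
Qed.

Definition en0 : nat := en (rnk [set j : site k N' | (j.2 < f j.1)%N]).

Lemma ket_gr (S : {set site k N'}) d :
  ket K S *m gr d = if d == en (rnk S) then ket K S else 0.
Proof.
apply/rowP => s; rewrite pjE; have [->|/negPf sS] := eqVneq s (rnk S).
  by rewrite [d == _]eq_sym; case: ifP => _; rewrite !mxE ?eqxx ?mulr1 ?mulr0.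
by case: ifP => _; rewrite !mxE ?eqxx ?sS ?mul0r.
Qed.

Lemma vac_gr w d : vacuum f w -> w *m gr d = if d == en0 then w else 0.
Proof. by case=> c _ ->; rewrite -scalemxAl ket_gr; case: ifP; rewrite ?scaler0. Qed.

Lemma vac_fil w : vacuum f w -> (w <= fil en0)%MS.
Proof.
case=> c _ ->; apply: scalemx_sub; apply/sub_pj => s; rewrite mxE eqxx /=.
by case: (s =P _) => [->|]; rewrite ?eqxx.
Qed.

(** The vacuum and the modes are homogeneous, so the module is graded. *)
Lemma M_gr w u d : vacuum f w -> (u <= Mcyc w)%MS -> (u *m gr d <= Mcyc w)%MS.
Proof.
move=> vw uM; move: d; apply: (cyc_ind (P := fun u => forall d, (u *m gr d <= Mcyc w)%MS)) uM.
- by apply: linpred_all => d; exact: linpred_mul.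
- by move=> d; rewrite vac_gr //; case: ifP; rewrite ?sub0mx ?cyc_id.
- move=> i {}u _ uM d; rewrite -mulmxA.
  have [id|di] := leqP i.+1 d; last by rewrite (raises_gr_lt (@E_raises i.+1) di) mulmx0 sub0mx.
  rewrite -{1}(subnK id) (raises_gr _ (@E_raises i.+1)) mulmxA.
  by apply: (cyc_stable (E := Efam)); exact: uM.
Qed.

(** Induction along the module: if a homogeneous component of [u] is the lowest part of some [y] in
    [Y w], then [Edef] applied to [y] has as lowest part the mode applied to that component. *)
Lemma M_sub_Y w d : vacuum f w ->
  ((Mcyc w :&: fil d)%MS *m gr d <= (Y w :&: fil d)%MS *m gr d)%MS.
Proof.
move=> vw; apply/row_subP => r; rewrite row_mul.
have := row_sub r (Mcyc w :&: fil d)%MS; rewrite sub_capmx => /andP[+ _].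
move: (row _ _) => u uM; move: d {r}.
apply: (cyc_ind (P := fun u => forall d, (u *m gr d <= (Y w :&: fil d)%MS *m gr d)%MS)) uM => [||i v vM IH d].
- by apply: linpred_all => d; exact: linpred_mul.
- move=> d; rewrite vac_gr //; case: ifP => [/eqP->|_]; last exact: sub0mx.
  rewrite -{1}[w](_ : w *m gr en0 = w); last by rewrite vac_gr // eqxx.
  by apply: submxMr; rewrite sub_capmx cyc_id vac_fil.
have [id|di] := leqP i.+1 d; last first.
  by rewrite -mulmxA (raises_gr_lt (@E_raises i.+1) di) mulmx0 sub0mx.
set d' := (d - i.+1)%N; have dE : d = (d' + i.+1)%N by rewrite subnK.
rewrite -mulmxA dE (raises_gr _ (@E_raises i.+1)) mulmxA -/(Emode i.+1) (M_Efr _ vw) ?M_gr //.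
have /submxP[r ->] := IH d'; rewrite mulmxA.
have : (r *m (Y w :&: fil d')%MS <= (Y w :&: fil d')%MS)%MS by exact: submxMl.
move: (r *m _) => y; rewrite sub_capmx => /andP[yY yf].
have iB : (0 < i.+1 <= B)%N by rewrite /= ltn_ord.
have [Ef <-] := Edef_lead iB yf; apply: submxMr; rewrite sub_capmx Ef andbT.
exact: Y_Edef.
Qed.

Lemma cap_fil0 (A : 'M[K]_fkdim) : \rank (A :&: fil 0)%MS = \rank A.
Proof. by rewrite fil0 capmx1. Qed.

Lemma rank_M_le w : vacuum f w -> (\rank (Mcyc w) <= Pdim)%N.
Proof.
move=> vw; apply: leq_trans (rank_Y w); rewrite -(cap_fil0 (Mcyc w)) -(cap_fil0 (Y w)).
apply: (rank_fil_le (pi := gr) (top := (\max_s en s).+1)) => [d||d]; first exact: fil_ker.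
  exact: fil_top.
exact: M_sub_Y.
Qed.

(** When the upper bound is attained, [fil_eq] reverses the inclusion of lowest parts given by
    [M_sub_Y]. *)
Lemma Y_sub_M w u d : vacuum f w -> (Pdim <= \rank (Mcyc w))%N ->
  (u <= Y w)%MS -> (u <= fil d)%MS -> (u *m gr d <= Mcyc w)%MS.
Proof.
move=> vw PM uY uf.
have : (u *m gr d <= (Mcyc w :&: fil d)%MS *m gr d)%MS.
  apply: (submx_trans (submxMr _ (_ : (u <= Y w :&: fil d)%MS))); first by rewrite sub_capmx uY.
  apply: (fil_eq (top := (\max_s en s).+1)) => [d'||d'|]; first exact: fil_ker.
  - exact: fil_top.
  - exact: M_sub_Y.
  - by rewrite !cap_fil0 (leq_trans (rank_Y w)).
move=> /submx_trans; apply; apply/row_subP => r; rewrite row_mul M_gr //.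
by have := row_sub r (Mcyc w :&: fil d)%MS; rewrite sub_capmx => /andP[].
Qed.

(** The pair filling the positions [n] and [n.+1], the parity of [n] deciding which of them is the
    even one; [inord] is faithful here when [n.+1 < N]. *)
Definition low_pair a (n : nat) : triple := (a, inord (uphalf n).*2, inord n./2.*2.+1).

Lemma low_uniq n (t : triple) : (n.+1 < N)%N -> good t ->
  (n <= t.1.2)%N -> (n <= t.2)%N -> (n.+1 <= ht t)%N /\ (ht t == n.+1) = (t == low_pair t.1.1 n).
Proof.
case: t => [[a x] y] nN /andP[/= ex oy] nx ny.
have h1 : (uphalf n <= x./2)%N by move: ex nx; lia.
have h2 : (n./2 <= y./2)%N by lia.
have h3 : (inord (uphalf n).*2 : 'I_N) = (uphalf n).*2 :> nat by rewrite inordK //; lia.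
have h4 : (inord n./2.*2.+1 : 'I_N) = n./2.*2.+1 :> nat by rewrite inordK //; lia.
rewrite /ht /=; split; first by lia.
rewrite /low_pair !xpair_eqE eqxx /= -!val_eqE /= h3 h4.
apply/eqP/andP => [e|[/eqP e1 /eqP e2]]; last by lia.
by split; apply/eqP; move: ex oy; lia.
Qed.

Lemma vac_low g g' w a n : (n.+1 < N)%N -> vacuum g w -> g a = n ->
  (forall b, g' b = g b + 2 * (b == a))%N -> vacuum g' (w *m pairop (low_pair a n)).
Proof.
move=> nN vw ga g'Emode; rewrite /pairop /low_pair /= mulmxA.
have [on|en_] := boolP (odd n).
  have -> : n./2.*2.+1 = n by move: on; lia.
  have -> : (uphalf n).*2 = n.+1 by move: on; lia.
  apply: (vac_up (f := fun b => g b + (b == a))%N); first by apply: (vac_up vw) => //; rewrite inordK //; lia.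
    by rewrite eqxx ga inordK // addn1.
  by move=> b; rewrite g'Emode; lia.
have -> : n./2.*2.+1 = n.+1 by move: en_; lia.
have -> : (uphalf n).*2 = n by move: en_; lia.
rewrite -mulmxA psi_anti mulmxN mulmxA -scaleN1r; apply: vac_scale; first by rewrite oppr_eq0 oner_eq0.
apply: (vac_up (f := fun b => g b + (b == a))%N); first by apply: (vac_up vw) => //; rewrite inordK //; lia.
  by rewrite eqxx ga inordK // addn1.
by move=> b; rewrite g'Emode; lia.
Qed.

(** The new vacuum is, up to a scalar, the lowest part of [w *m yop l ^+ nle l]: in the product over
    the components with [f a <= l], each factor contributes its lowest pair, which fills two
    positions. *)
Lemma vac_raise w l : vacuum f w -> (Pdim <= \rank (Mcyc w))%N ->
    (forall a, f a <= l -> (f a).+1 < N)%N ->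
  exists2 w', vacuum (fun a => f a + 2 * (f a <= l))%N w' & (w' <= Mcyc w)%MS.
Proof.
move=> vw PM fN.
pose tt a := wgt a l *: (psiL a l *m phiL a l).
have fold_vac r : uniq r -> all (fun a => f a <= l)%N r -> exists d,
    let u := w *m \prod_(a <- r) tt a in
    (u <= fil d)%MS /\ vacuum (fun a => f a + 2 * (a \in r))%N (u *m gr d).
  elim/last_ind: r => [_ _|r a IH].
    exists en0; rewrite /= big_nil [w *m 1](mulmx1 w) vac_fil // vac_gr // eqxx; split=> //.
    by apply: vac_ext vw => a; rewrite muln0 addn0.
  rewrite rcons_uniq all_rcons => /andP[ar ur] /andP[al lr].
  have [d [uf vu]] := IH ur lr; exists (d + (f a).+1)%N.
  rewrite /= big_rcons; set pr_ := \prod_(_ <- _) _ in uf vu *.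
  rewrite [w *m (pr_ * tt a)](mulmxA w pr_); move: (w *m pr_) uf vu => u uf vu.
  rewrite /tt pairE -operZ.
  set c := (fun t => _).
  have c0 t : good t -> (ht t < (f a).+1)%N -> c t = 0.
    move=> gt tn; rewrite /c; case: eqP => [e|_]; last by rewrite mul0r mulr0.
    case: (boolP (fresh f t)) => [/andP[fx fy]|_]; last by rewrite mul0r !mulr0.
    by rewrite e in fx fy; have [h _] := low_uniq (fN a al) gt fx fy; lia.
  have [H1 ->] := oper_lead c0 uf; split=> //.
  have -> : oper (fun t => (ht t == (f a).+1)%:R * c t) = wgt a l *: pairop (low_pair a (f a)).
    have gl : good (low_pair a (f a)).
      by have fNa := fN a al; rewrite /good /low_pair /= !inordK /= ?odd_double //; lia.
    have [lx ly] : fresh f (low_pair a (f a)) /\ ht (low_pair a (f a)) = (f a).+1.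
      by have fNa := fN a al; rewrite /fresh /ht /low_pair /= !inordK; lia.
    rewrite /oper (bigD1 (low_pair a (f a))) //= big1 => [|t /andP[gt tl]].
      by rewrite addr0 /c ly !eqxx lx subnn expr0 !mul1r mulr1.
    rewrite /c; case: (t.1.1 =P a) => [e|_]; last by rewrite mul0r !mulr0 scale0r.
    case: (boolP (fresh f t)) => [/andP[fx fy]|_]; last by rewrite mul0r !mulr0 scale0r.
    rewrite e in fx fy.
    by have [_ ->] := low_uniq (fN a al) gt fx fy; rewrite e (negPf tl) mul0r scale0r.
  rewrite -scalemxAr; apply: vac_scale; first exact: wgt_neq0.
  apply: (vac_low (fN a al) vu); first by rewrite (negPf ar) muln0 addn0.
  move=> b; rewrite mem_rcons inE; case: eqP => [->|_]; first by rewrite (negPf ar); lia.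
  by rewrite /=; lia.
have [|d [uf vu]] := fold_vac (enum [pred a | (f a <= l)%N]) (enum_uniq _).
  by apply/allP => a; rewrite mem_enum.
(* The factorial turns the product into a power of [yop l], by [yop_expE]. *)
exists ((nle l)`!%:R *: (w *m (\prod_(a <- enum [pred a | (f a <= l)%N]) tt a) *m gr d)).
  apply: vac_scale; first by rewrite pnatr_eq0 -lt0n fact_gt0.
  by apply: vac_ext vu => a; rewrite mem_enum.
rewrite scalemxAl scaler_nat; apply: Y_sub_M => //; last first.
  by rewrite -scaler_nat scalemx_sub.
have yw n : (w *m yop l ^+ n <= Y w)%MS.
  elim: n => [|n IH]; first by rewrite expr0 [w *m 1](mulmx1 w) cyc_id.
  by rewrite exprSr [w *m (_ * _)](mulmxA w); apply: cyc_stable.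
by have := yw (nle l); have [-> _] := yop_expE l; rewrite -[_ *+ _]scaler_nat -scalemxAr scaler_nat.
Qed.

End Upper.

(** * Lower bound for the dimension *)

Section Counting.
Variables (k B : nat).
Implicit Types (f g : 'I_k -> nat) (a b c : 'I_k).

Lemma nleE f l : nle f l = (\sum_b (f b <= l)%N)%N.
Proof. by rewrite /nle -sum1_card big_mkcond. Qed.

Lemma sum_mem1 a (n : nat) : (\sum_b (b == a) * n = n)%N.
Proof. by rewrite (bigD1 a) //= eqxx mul1n big1 ?addn0 // => b /negPf->. Qed.

(** The filling after the top fermion of [c] moves to the first hole of [a]. *)
Definition move f a c : 'I_k -> nat := fun b => (f b + (b == a) - (b == c))%N.

Lemma nle_move f a c l : a != c -> (0 < f c)%N ->
  (nle (move f a c) l + (l == f a) = nle f l + (l == (f c).-1))%N.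
Proof.
move=> ac fc; rewrite !nleE -[X in (_ + X)%N](sum_mem1 a) -[X in (_ = _ + X)%N](sum_mem1 c).
rewrite -!big_split; apply: eq_bigr => b _ /=; rewrite /move.
have [->|ba] := eqVneq b a; first by rewrite (negPf ac) /=; lia.
by have [->|bc] := eqVneq b c; lia.
Qed.

Lemma nle_up f a l : (nle (fun b => f b + (b == a)) l + (l == f a) = nle f l)%N.
Proof.
rewrite !nleE -[X in (_ + X)%N](sum_mem1 a) -big_split; apply: eq_bigr => b _ /=.
by have [->|ba] := eqVneq b a; lia.
Qed.

Lemma nle_le f l l' : (l <= l')%N -> (nle f l <= nle f l')%N.
Proof. by move=> ll; apply: subset_leq_card; apply/subsetP => a; rewrite !inE => /leq_trans; apply. Qed.

Lemma sum_move f a c : a != c -> (f a < B)%N -> (0 < f c <= B)%N ->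
  (\sum_b (B - move f a c b) = \sum_b (B - f b))%N.
Proof.
move=> ac fa fc.
have : (\sum_b (B - move f a c b + (b == a) * 1) = \sum_b (B - f b + (b == c) * 1))%N.
  apply: eq_bigr => b _; rewrite /move.
  have [->|ba] := eqVneq b a; first by rewrite (negPf ac) /=; lia.
  by have [->|bc] := eqVneq b c; lia.
by rewrite !big_split /= !sum_mem1 => /addIn.
Qed.

(** For [l = f a], and under the gap condition of [M_ker_hop], this vacuum generates the kernel of
    the transport from [c] to [a]. *)
Definition raise f l : 'I_k -> nat := fun b => (f b + 2 * (f b <= l))%N.

Lemma nle_raise_min f n l : (forall b, n <= f b)%N -> 
  (nle (raise f n) l + ((l == n) + (l == n.+1)) * nle f n = nle f l)%N.
Proof.
move=> nf; rewrite !nleE big_distrr -big_split; apply: eq_bigr => b _ /=.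
by have := nf b; rewrite /raise; lia.
Qed.

(** With p and q the values of [nle f] at [n] and [n.+1], this is (p+1)(q+1) = (q-p+1) + p(q+2). No
    filling lies strictly between [n.+1] and [f c], so q is also the value at [(f c).-1], where
    [move] adds one. *)
Lemma Pdim_min f n a c : (forall b, n <= f b)%N -> f a = n -> (n.+2 <= f c <= B)%N ->
    (forall b, (f b <= n.+1) || (f c <= f b))%N ->
  (Pdim B f = Pdim B (raise f n) + Pdim B (move f a c))%N.
Proof.
move=> nf fa fc gap.
have ac : a != c by apply: contraTneq fc => <-; lia.
have nB : (n < B)%N by lia.
have n1B : (n.+1 < B)%N by lia.
have gB : ((f c).-1 < B)%N by lia.
have ngE : nle f (f c).-1 = nle f n.+1.
  by apply: eq_card => b; rewrite !inE; have := gap b; lia.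
have moveE l : (nle (move f a c) l).+1 = ((nle f l).+1 + (l == (f c).-1) - (l == n))%N.
  have := nle_move l ac (_ : 0 < f c)%N; rewrite fa => /(_ _)/wrap[|]; first by lia.
  by case: (l == n); case: (l == _); lia.
have raiseE l : (nle (raise f n) l).+1 = ((nle f l).+1 - ((l == n) + (l == n.+1)) * nle f n)%N.
  by have := nle_raise_min l nf; lia.
pose o := Ordinal nB; pose o1 := Ordinal n1B; pose og := Ordinal gB.
have o1n : o1 != o by rewrite -val_eqE /=; lia.
have ogn : og != o by rewrite -val_eqE /=; lia.
pose Z := (\prod_(i < B | (i != o) && (i != o1)) (nle f i).+1)%N.
have splitE g o' : o' != o -> Pdim B g = ((nle g o).+1 * ((nle g o').+1 *
    \prod_(i < B | (i != o) && (i != o')) (nle g i).+1))%N.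
  by move=> o'n; rewrite /Pdim (bigD1 o) //= (bigD1 o' o'n).
(* [og] may coincide with [o1]; comparing the two splittings of [Pdim B f] covers both cases. *)
have ZE : (\prod_(i < B | (i != o) && (i != og)) (nle f i).+1 = Z)%N.
  have := splitE f og ogn; rewrite (splitE f o1 o1n) /= ngE.
  by move/eqP; rewrite !eqn_pmul2l // => /eqP.
rewrite (splitE f o1 o1n) (splitE _ o1 o1n) (splitE _ og ogn) -/Z.
rewrite (_ : \prod_(i < B | (i != o) && (i != o1)) (nle (raise f n) i).+1 = Z)%N; last first.
  apply: eq_bigr => i /andP[]; rewrite -!val_eqE /= => /negPf i1 /negPf i2; rewrite raiseE.
  by rewrite i1 i2 subn0.
rewrite (_ : \prod_(i < B | (i != o) && (i != og)) (nle (move f a c) i).+1 = Z)%N; last first.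
  rewrite -ZE; apply: eq_bigr => i /andP[]; rewrite -!val_eqE /= => /negPf i1 /negPf i2.
  by rewrite moveE i1 i2 addn0 subn0.
rewrite !raiseE !moveE /= !eqxx ngE.
have -> : (n.+1 == n) = false by lia.
have -> : (n == n.+1) = false by lia.
have -> : (n == (f c).-1) = false by lia.
have -> : ((f c).-1 == n) = false by lia.
have le1 : (nle f n <= nle f n.+1)%N by apply: nle_le.
move: le1; move: (Z) (nle f n) (nle f n.+1) => z p q pq.
have [r ->] : exists r, q = (p + r)%N by exists (q - p)%N; lia.
rewrite (_ : p.+1 - _ = 1)%N; last by lia.
rewrite (_ : (p + r).+1 - _ = r.+1)%N; last by lia.
rewrite (_ : p.+1 + _ - _ = p)%N; last by lia.
rewrite (_ : (p + r).+1 + _ - _ = (p + r).+2)%N; last by lia.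
nia.
Qed.

(** With no filling equal to [n.+1], raising drops the levels [n] and [n.+1] from the list of counts
    and inserts two empty levels at the bottom. *)
Lemma nle_raise f n l : (forall b, (f b <= n) || (n.+2 <= f b))%N ->
  nle (raise f n) l = if (l < 2)%N then 0%N else if (l < n.+2)%N then nle f (l - 2) else nle f l.
Proof.
move=> gap; case: ifP => l2.
  by apply: eq_card0 => b; rewrite !inE /raise; have := gap b; lia.
by case: ifP => ln; apply: eq_card => b; rewrite !inE /raise; have := gap b; lia.
Qed.

(** The levels dropped by [raise] and those changed by [move] all carry the same count p, and the
    identity is (p+1)^2 = 1 + p(p+2). *)
Lemma Pdim_gap f a c : ((f a).+2 <= f c <= B)%N ->
    (forall b, (f b <= f a) || (f c <= f b))%N ->
  (Pdim B f = Pdim B (raise f (f a)) + Pdim B (move f a c))%N.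
Proof.
set n := f a => fc gap.
have ac : a != c by apply: contraTneq fc => <-; rewrite -/n; lia.
have nB : (n < B)%N by lia.
have n1B : (n.+1 < B)%N by lia.
have gB : ((f c).-1 < B)%N by lia.
pose o := Ordinal nB; pose og := Ordinal gB.
have ogn : og != o by rewrite -val_eqE /=; lia.
have nlE l : (n <= l < f c)%N -> nle f l = nle f n.
  by move=> nl; apply: eq_card => b; rewrite !inE; have := gap b; lia.
have splitE g : Pdim B g = ((nle g o).+1 * ((nle g og).+1 *
    \prod_(i < B | (i != o) && (i != og)) (nle g i).+1))%N.
  by rewrite /Pdim (bigD1 o) //= (bigD1 og ogn).
have moveE l : (nle (move f a c) l).+1 = ((nle f l).+1 + (l == (f c).-1) - (l == n))%N.
  have := nle_move l ac (_ : 0 < f c)%N; rewrite -/n => /(_ _)/wrap[|]; first by lia.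
  by case: (l == n); case: (l == _); lia.
have fE : Pdim B f = ((nle f n).+1 * ((nle f n).+1 * Pdim B (raise f n)))%N.
  rewrite /Pdim -!(big_mkord predT (fun l => (nle _ l).+1)).
  rewrite (big_cat_nat (n := n)) //=; last by lia.
  rewrite (big_ltn (m := n)) // (big_ltn (m := n.+1)) //= (nlE n.+1); last by lia.
  rewrite [in RHS](big_cat_nat (n := 2)) //=; last by lia.
  rewrite [in RHS](big_cat_nat (m := 2) (n := n.+2)) //=.
  have gap2 b : (f b <= n)%N || (n.+2 <= f b)%N by have := gap b; lia.
  have -> : (\prod_(0 <= l < 2) (nle (raise f n) l).+1 = 1)%N.
    by rewrite big_nat big1 // => l /andP[_ l2]; rewrite nle_raise // l2.
  rewrite mul1n.
  have -> : (\prod_(2 <= l < n.+2) (nle (raise f n) l).+1 = \prod_(0 <= l < n) (nle f l).+1)%N.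
    rewrite (big_addn 0 n.+2 2 predT) subSS subSS subn0.
    apply: eq_big_nat => l /andP[_ ln]; rewrite nle_raise // addnK.
    have -> : (l + 2 < 2)%N = false by lia.
    by have -> : (l + 2 < n.+2)%N = true by lia.
  have -> : (\prod_(n.+2 <= l < B) (nle (raise f n) l).+1 = \prod_(n.+2 <= l < B) (nle f l).+1)%N.
    apply: eq_big_nat => l /andP[nl _].
    rewrite nle_raise //.
    have -> : (l < 2)%N = false by lia.
    by have -> : (l < n.+2)%N = false by lia.
  by rewrite mulnCA; congr (_ * _)%N; rewrite mulnCA.
pose Z := (\prod_(i < B | (i != o) && (i != og)) (nle f i).+1)%N.
have ZE : Pdim B (raise f n) = Z.
  move/eqP: fE; rewrite splitE /= (nlE (f c).-1); last by lia.
  by rewrite !eqn_pmul2l // => /eqP.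
rewrite ZE fE ZE (splitE (move f a c)).
rewrite (_ : \prod_(i < B | (i != o) && (i != og)) (nle (move f a c) i).+1 = Z)%N; last first.
  apply: eq_bigr => i /andP[]; rewrite -!val_eqE /= => /negPf i1 /negPf i2.
  by rewrite moveE i1 i2 addn0 subn0.
rewrite !moveE /= !eqxx (nlE (f c).-1); last by lia.
have -> : (n == (f c).-1) = false by lia.
have -> : ((f c).-1 == n) = false by lia.
move: (Z) (nle f n) => z p.
rewrite (_ : p.+1 + _ - _ = p)%N; last by lia.
rewrite (_ : p.+1 + _ - _ = p.+2)%N; last by lia.
nia.
Qed.

(** Only the last level, [f a], contributes a factor other than 1. *)
Lemma Pdim_top f a : (forall b, B <= (f b).+1)%N -> (f a).+1 = B ->
  Pdim B f = (Pdim B (fun b => f b + (b == a))).+1%N.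
Proof.
move=> fB fa; have aB : (f a < B)%N by lia.
have p1 g : (forall b, B <= (g b).+1)%N -> Pdim B g = (nle g (f a)).+1.
  move=> gB; rewrite /Pdim (bigD1 (Ordinal aB)) //= big1 ?muln1 // => l.
  rewrite -val_eqE /= => la; apply/eqP; rewrite eqSS; apply/eqP; apply: eq_card0 => b.
  by rewrite !inE; have := gB b; have := ltn_ord l; lia.
rewrite !p1 //; last by move=> b; have := fB b; lia.
by have := nle_up f a (f a); rewrite eqxx; lia.
Qed.

End Counting.

(** * Transport between components and the induction on the filling *)

Section Lower.
Variables (K : numFieldType) (k N' B : nat).
Local Notation N := N'.+1.
Local Notation fkdim := (fdim (site k N')).
Local Notation Emode := (mode K k N').
Local Notation Efam := (@mode_fam K k N' B).
Local Notation crea := (@creation K k N').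
Local Notation anni := (@annihilation K k N').
Local Notation pairop := (@pair_op K k N').
Local Notation oper := (@quad_op K k N').
Local Notation triple := (triple k N').
Local Notation low := (@low_pair k N').
Local Notation Mcyc := (@Mcyc K k N' B).
Implicit Types (a b c : 'I_k) (l : 'I_B) (t : triple) (u v w : 'rV[K]_fkdim) (f g : 'I_k -> nat).

Lemma E_sum n : Emode n = \sum_(t | good t && (ht t == n)) pairop t.
Proof.
rewrite /mode /quad_op [RHS]big_mkcondr; apply: eq_bigr => t _.
by case: eqP => _; rewrite ?scale1r ?scale0r.
Qed.

Lemma pr_sq t : pairop t *m pairop t = 0.
Proof. by rewrite {2}/pair_op mulmxA pr_psi /pair_op mulmxA psi_sq !mul0mx. Qed.

(* At the lowest level only the components with the smallest filling move. *)
Lemma vac_lowest f w n : (forall b, n <= f b)%N -> (n < B)%N -> (n.+1 < N)%N -> vacuum f w ->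
  exists2 w', vacuum (raise f n) w' & (w' <= Mcyc w)%MS.
Proof.
move=> nf nB nN vw.
have EM i : (w *m Emode n.+1 ^+ i <= Mcyc w)%MS.
  elim: i => [|i IH]; first by rewrite expr0 [w *m 1](mulmx1 w) cyc_id.
  rewrite exprSr [w *m (_ * _)](mulmxA w).
  exact: (cyc_stable (E := Efam) (Ordinal nB)).
have Ei i : w *m Emode n.+1 ^+ i = w *m Efr K N' f n.+1 ^+ i.
  elim: i => // i IH; rewrite !exprSr ![w *m (_ * _)](mulmxA w) -IH.
  exact: M_Efr vw (EM i).
(* By minimality of [n], the fresh pairs of height [n.+1] are the lowest pairs of the components
   filled exactly up to [n]; they commute and square to zero. *)
have EfrE : Efr K N' f n.+1 = \sum_(a <- enum [pred a | (f a <= n)%N]) pairop (low a n).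
  rewrite big_enum /Efr /quad_op /=.
  rewrite (eq_bigr (fun t => if fresh f t && (ht t == n.+1) then pairop t else 0)); last first.
    by move=> t _; case: ifP => _; rewrite ?scale1r ?scale0r.
  rewrite -big_mkcondr (reindex_onto (fun a => low a n) (fun t => t.1.1)) /=; last first.
    move=> t /andP[gt /andP[/andP[fx fy] hn]].
    have [_ e] := low_uniq nN gt (leq_trans (nf _) fx) (leq_trans (nf _) fy).
    by move: hn; rewrite e => /eqP <-.
  apply: eq_bigl => a; rewrite eqxx andbT inE.
  have x2 : (uphalf n).*2 = (n + odd n)%N by lia.
  have y2 : n./2.*2.+1 = (n + ~~ odd n)%N by lia.
  rewrite /good /fresh /ht /low_pair /= !inordK ?x2 ?y2; have := nf a; lia.
have [H _] := @sq0_sum_exp _ _ (fun a => pairop (low a n)) (fun a b => pr_comm K _ _)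
  (fun a => pr_sq _) (enum [pred a | (f a <= n)%N]).
have fold_vac r : uniq r -> all (fun a => f a <= n)%N r ->
    vacuum (fun a => f a + 2 * (a \in r))%N (w *m \prod_(a <- r) pairop (low a n)).
  elim/last_ind: r => [_ _|r a IH].
    by rewrite big_nil [w *m 1](mulmx1 w); apply: vac_ext vw => a; rewrite muln0 addn0.
  rewrite rcons_uniq all_rcons => /andP[ar ur] /andP[an rn].
  rewrite big_rcons [w *m (_ * _)](mulmxA w); apply: (vac_low nN (IH ur rn)).
    by rewrite (negPf ar) muln0 addn0; have := nf a; lia.
  move=> b; rewrite mem_rcons inE; case: eqP => [->|_]; first by rewrite (negPf ar); lia.
  by rewrite /=; lia.
pose m := size (enum [pred a | (f a <= n)%N]).
exists (w *m Emode n.+1 ^+ m) => //; rewrite Ei EfrE H -[_ *+ _]scaler_nat -scalemxAr.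
apply: vac_scale; first by rewrite pnatr_eq0 -lt0n fact_gt0.
apply: vac_ext (fold_vac _ (enum_uniq _) _) => [a|]; first by rewrite mem_enum.
by apply/allP => a; rewrite mem_enum.
Qed.

(** Commuting past a mode leaves the partner [z] of [x] in the pair of height [n]; the sign records
    whether [x] is its psi or its phi. *)
Lemma del_E c (x : 'I_N) n : anni c x *m Emode n = Emode n *m anni c x +
  \sum_(z : 'I_N | (x + z + 1 == n.*2)%N) (- (-1) ^+ x) *: crea c z.
Proof.
have del_pr t : anni c x *m pairop t = pairop t *m anni c x +
    (((c, x) == (t.1.1, t.2))%:R *: crea t.1.1 t.1.2 - ((c, x) == (t.1.1, t.1.2))%:R *: crea t.1.1 t.2).
  rewrite /pair_op mulmxA del_psi mulmxBl mul_scalar_mx -!mulmxA del_psi mulmxBr mul_mx_scalar.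
  by rewrite opprB addrCA.
rewrite E_sum mulmx_sumr mulmx_suml.
under eq_bigr do rewrite del_pr.
rewrite big_split /=; congr (_ + _); rewrite sumrB.
rewrite [X in X - _](_ : _ = \sum_(z : 'I_N) if odd x && (x + z + 1 == n.*2)%N then crea c z else 0); last first.
  rewrite big_mkcond triple_sum (bigD1 c) //= [X in _ + X]big1 ?addr0; last first.
    move=> b bc; rewrite big1 // => z _; rewrite big1 // => y _.
    by rewrite xpair_eqE [c == b]eq_sym (negPf bc) scale0r if_same.
  apply: eq_bigr => z _; rewrite (bigD1 x) //= big1 => [|y yx].
    rewrite eqxx scale1r addr0 /good /ht /=; congr (if _ then _ else _).
    by have := ltn_ord x; lia.
  by rewrite xpair_eqE eqxx [x == y]eq_sym (negPf yx) scale0r if_same.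
rewrite [X in _ - X](_ : _ = \sum_(z : 'I_N) if ~~ odd x && (x + z + 1 == n.*2)%N then crea c z else 0); last first.
  rewrite big_mkcond triple_sum (bigD1 c) //= [X in _ + X]big1 ?addr0; last first.
    move=> b bc; rewrite big1 // => z _; rewrite big1 // => y _.
    by rewrite xpair_eqE [c == b]eq_sym (negPf bc) scale0r if_same.
  rewrite exchange_big /=.
  apply: eq_bigr => z _; rewrite (bigD1 x) //= big1 => [|y yx].
    rewrite eqxx scale1r addr0 /good /ht /=; congr (if _ then _ else _).
    by lia.
  by rewrite xpair_eqE eqxx [x == y]eq_sym (negPf yx) scale0r if_same.
rewrite -sumrB [RHS]big_mkcond; apply: eq_bigr => z _; rewrite -signr_odd.
by case: (odd x); case: (_ == n.*2); rewrite /= ?subr0 ?sub0r ?expr1 ?expr0 ?opprK ?scale1r ?scaleN1r ?oppr0.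
Qed.

(* Transports a fermion from [c] to [a], or from [a] to [c], lowering its
   position by [q]; with this relative sign the sum commutes with all [Emode n]. *)
Definition hop a c q : 'M[K]_fkdim := \sum_(y : 'I_N | (y + q < N)%N)
  (anni c (inord (y + q)) *m crea a y - (-1) ^+ q *: (anni a (inord (y + q)) *m crea c y)).

(** The commutators of both halves of [hop] are sums over [y + q + z + 1 = n.*2], exchanged by
    swapping [y] and [z]. As [y + q] and [z] have opposite parities, they cancel for the chosen
    relative sign; the bound on [n] ensures that the truncation cuts off no term. *)
Lemma hop_E a c q n : (n.*2 <= N)%N -> Emode n *m hop a c q = hop a c q *m Emode n.
Proof.
move=> nN; apply/eqP; rewrite eq_sym -subr_eq0 /hop mulmx_suml mulmx_sumr -sumrB.
have Epsi b y : crea b y *m Emode n = Emode n *m crea b y by rewrite /mode oper_psi.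
pose Q c (y : 'I_N) := \sum_(z : 'I_N | (y + q + z + 1 == n.*2)%N) (- (-1) ^+ (y + q)) *: crea c z.
have step b c' (y : 'I_N) : (y + q < N)%N -> anni c' (inord (y + q)) *m crea b y *m Emode n =
    Emode n *m (anni c' (inord (y + q)) *m crea b y) + Q c' y *m crea b y.
  move=> yq; rewrite -mulmxA Epsi mulmxA del_E mulmxDl -mulmxA; congr (_ + _ *m _).
  by rewrite inordK.
rewrite (eq_bigr (fun y => Q c y *m crea a y - (-1) ^+ q *: (Q a y *m crea c y))); last first.
  move=> y yq; rewrite mulmxBl mulmxBr -scalemxAl -scalemxAr !step //.
  by rewrite scalerDr opprD addrACA [X in X - _]addrC addrK.
have QE b b' : \sum_(y : 'I_N | (y + q < N)%N) Q b y *m crea b' y =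
    \sum_(y : 'I_N) \sum_(z : 'I_N | (y + q + z + 1 == n.*2)%N) (- (-1) ^+ (y + q)) *: (crea b z *m crea b' y).
  rewrite big_mkcond; apply: eq_bigr => y _; rewrite /Q mulmx_suml.
  case: ifP => yq; first by apply: eq_bigr => z _; rewrite scalemxAl.
  by rewrite big_pred0 // => z; apply/eqP; lia.
rewrite sumrB -scaler_sumr !QE subr_eq0; apply/eqP.
rewrite [in RHS](exchange_big_dep predT) //= scaler_sumr; apply: eq_bigr => y _.
rewrite scaler_sumr; apply: eq_big => [z|z yz]; first by lia.
rewrite (psi_anti K c) scalerN scalerA -scaleNr; congr (_ *: _).
have -> : (-1) ^+ (y + q) = - (-1) ^+ z :> K.
  rewrite -(signr_odd _ (y + q)) -(signr_odd _ z).
  have -> : odd (y + q) = ~~ odd z by lia.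
  by case: (odd z); rewrite /= ?expr0 ?expr1 ?opprK.
by rewrite exprD !opprK mulrN mulrCA -expr2 sqrr_sign mulr1.
Qed.

(** [q] is the distance from the first hole of [a] to the top fermion of [c]. Only [y = f a]
    survives: below it the site of [a] is filled, above it the site of [c] is empty, and the
    opposite transport always vanishes. *)
Lemma hop_move f w a c : a != c -> (f a < f c)%N -> (f c <= N)%N -> vacuum f w ->
  vacuum (move f a c) (w *m hop a c ((f c).-1 - f a)).
Proof.
move=> ac fac fcN vw; set q := ((f c).-1 - f a)%N.
have faN : (f a < N)%N by lia.
pose ya : 'I_N := Ordinal faN.
have dpa (x : 'I_N) y : anni c x *m crea a y = - (crea a y *m anni c x).
  by rewrite del_psi xpair_eqE eq_sym (negPf ac) raddf0 add0r.
have dpc (x : 'I_N) y : anni a x *m crea c y = - (crea c y *m anni a x).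
  by rewrite del_psi xpair_eqE (negPf ac) raddf0 add0r.
have ac0 (y : 'I_N) : (y + q < N)%N -> w *m (anni a (inord (y + q)) *m crea c y) = 0.
  move=> yq; have xE : (inord (y + q) : 'I_N) = (y + q)%N :> nat by rewrite inordK.
  have [yf|fy] := ltnP y (f c); first by rewrite dpc mulmxN mulmxA (vac_psi vw) // mul0mx oppr0.
  by rewrite mulmxA (vac_del vw) ?mul0mx // xE; lia.
rewrite /hop mulmx_sumr (bigD1 ya) /=; last by lia.
rewrite big1 ?addr0 => [|y /andP[yq]].
  rewrite mulmxBr -scalemxAr (ac0 ya) ?scaler0 ?subr0 ?mulmxA /=; last by lia.
  have xE : (inord (f a + q) : 'I_N) = (f c).-1 :> nat by rewrite inordK; lia.
  apply: (vac_up (f := fun b => f b - (b == c))%N).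
  - by apply: (vac_down vw) => //; rewrite xE; lia.
  - by rewrite (negPf ac) subn0.
  - move=> b; rewrite /move; have [->|bc] := eqVneq b c; last by lia.
    by rewrite eq_sym (negPf ac); lia.
rewrite -val_eqE /= => ya'.
have xE : (inord (y + q) : 'I_N) = (y + q)%N :> nat by rewrite inordK.
rewrite mulmxBr -scalemxAr ac0 // scaler0 subr0.
have [yf|fy] := ltnP y (f a); first by rewrite dpa mulmxN mulmxA (vac_psi vw) // mul0mx oppr0.
by rewrite mulmxA (vac_del vw) ?mul0mx // xE; lia.
Qed.

(** For fillings at distance at most [q], each term creates at a filled site or annihilates at an
    empty one. *)
Lemma hop_kill g w a c q : a != c -> (g c <= g a + q)%N -> (g a <= g c + q)%N -> vacuum g w ->
  w *m hop a c q = 0.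
Proof.
move=> ac gca gac vw; rewrite /hop mulmx_sumr big1 // => y yq.
have xE : (inord (y + q) : 'I_N) = (y + q)%N :> nat by rewrite inordK.
have half a' c' : a' != c' -> (g c' <= g a' + q)%N -> w *m (anni c' (inord (y + q)) *m crea a' y) = 0.
  move=> ac' gc; have [yg|gy] := ltnP y (g a'); last first.
    by rewrite mulmxA (vac_del vw) ?mul0mx // xE; lia.
  rewrite del_psi xpair_eqE eq_sym (negPf ac') raddf0 add0r mulmxN mulmxA (vac_psi vw) //.
  by rewrite mul0mx oppr0.
by rewrite mulmxBr -scalemxAr !half // ?scaler0 ?subr0 // eq_sym.
Qed.

(** The inequality half of the exact sequence: [T] maps onto the module of [w *m T], and its kernel
    contains that of [w']. *)
Lemma rank_step w w' T : (forall i, Efam i *m T = T *m Efam i) -> (w' <= Mcyc w)%MS ->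
  w' *m T = 0 -> (\rank (Mcyc (w *m T)) + \rank (Mcyc w') <= \rank (Mcyc w))%N.
Proof.
move=> ET w'M w'T; rewrite -(mxrank_mul_ker (Mcyc w) T).
rewrite (cyc_comm w ET) leq_add2l mxrankS // sub_capmx (cyc_subc w'M) /=.
by apply/row_subP => r; apply/sub_kermxP; apply: (cyc_kill ET w'T); exact: row_sub.
Qed.

Hypothesis BN : (B.*2 <= N)%N.

(** Outer induction on a lower bound [n] of the filling, increasing to [B]; inner induction on the
    number of components attaining it. [move] lowers that number and [raise] empties the level [n].
    The bound on the total depth supplies a component full enough to give up a fermion. *)
Lemma rank_M_ge f w : (forall b, f b <= B)%N -> (\sum_b (B - f b) < k)%N -> vacuum f w ->
  (Pdim B f <= \rank (Mcyc w))%N.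
Proof.
suff H j n : (n + j = B)%N -> forall m f w, (forall b, n <= f b)%N -> (nle f n <= m)%N ->
    (forall b, f b <= B)%N -> (\sum_b (B - f b) < k)%N -> vacuum f w -> (Pdim B f <= \rank (Mcyc w))%N.
  by move=> fB fk vw; apply: (H B 0%N (add0n B) k f) => //; rewrite -[k in (_ <= k)%N]card_ord max_card.
elim: j n => [|j IHj] n nj.
  move=> m {}f {}w nf _ fB fk vw.
  rewrite /Pdim big1 => [|l _].
    rewrite lt0n mxrank_eq0; apply: contraNneq (vac_neq0 vw) => M0.
    by rewrite -submx0 -M0 cyc_id.
  by apply/eqP; rewrite eqSS; apply/eqP; apply: eq_card0 => b; rewrite !inE; have := nf b; have := ltn_ord l; lia.
elim=> [|m IHm] {}f {}w nf nm fB fk vw.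
  apply: (IHj n.+1 _ k) => //; first by lia.
    move=> b; rewrite ltn_neqAle nf andbT; apply: contraTneq nm => nb.
    by rewrite -ltnNge; apply/card_gt0P; exists b; rewrite !inE -nb.
  by rewrite -[k in (_ <= k)%N]card_ord max_card.
have [|mn] := leqP (nle f n) m; first by move=> nm'; exact: IHm.
have /card_gt0P[a] : (0 < nle f n)%N by lia.
rewrite !inE => an; have fa : f a = n by have := nf a; lia.
have nB : (n < B)%N by lia.
have nN : (n.+1 < N)%N by lia.
have [w' vw' w'M] := vac_lowest nf nB nN vw.
(* At the last level, [n.+1 = B], the transport is replaced by creation at the first hole of [a],
   which also commutes with the modes. *)
case: j => [|j] in IHj nj *.
  have faN : (f a < N)%N by lia.
  have w'0 : w' *m crea a (Ordinal faN) = 0.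
    by apply: (vac_psi vw'); rewrite /raise /= an; lia.
  have ET i : Efam i *m crea a (Ordinal faN) = crea a (Ordinal faN) *m Efam i by exact: oper_psi.
  apply: leq_trans (rank_step ET w'M w'0).
  rewrite (Pdim_top (a := a)); first last.
  - by lia.
  - by move=> b; have := nf b; lia.
  rewrite -addn1 leq_add //.
    apply: IHm.
    + by move=> b; have := nf b; lia.
    + by have := nle_up f a n; rewrite fa eqxx; lia.
    + by move=> b; have [->|] := eqVneq b a; have := fB b; lia.
    + by apply: leq_ltn_trans fk; apply: leq_sum => b _; lia.
    + exact: vac_up vw _ _.
  rewrite lt0n mxrank_eq0; apply: contraNneq (vac_neq0 vw') => M0.
  by rewrite -submx0 -M0 cyc_id.
(* Otherwise every component would have depth at least 1, against [fk]. *)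
have /existsP[c0 c0n] : [exists c, n.+2 <= f c]%N.
  apply: contraLR fk => /existsPn H; rewrite -leqNgt.
  rewrite -[X in (X <= _)%N](card_ord k) -sum1_card; apply: leq_sum => b _.
  by have := H b; lia.
(* The least such filling, as required by the gap condition of [Pdim_min]. *)
case: (@arg_minnP _ c0 (fun c => n.+2 <= f c)%N f c0n) => c cn cmin.
have ac : a != c by apply: contraTneq cn => <-; lia.
have fcB := fB c; have fcN : (f c <= N)%N by lia.
have fac : (f a < f c)%N by lia.
have vw'' := hop_move ac fac fcN vw.
have ET i : Efam i *m hop a c ((f c).-1 - f a) = hop a c ((f c).-1 - f a) *m Efam i.
  by apply: hop_E; have := ltn_ord i; lia.
have w'0 : w' *m hop a c ((f c).-1 - f a) = 0.
  by apply: (hop_kill ac _ _ vw'); rewrite /raise; lia.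
apply: leq_trans (rank_step ET w'M w'0).
rewrite (Pdim_min (n := n) (a := a) (c := c)) //; last 2 first.
- by lia.
- by move=> b; have := cmin b; lia.
rewrite addnC; apply: leq_add.
  apply: IHm vw''.
  - by move=> b; rewrite /move; have := nf b; have [->|] := eqVneq b c; lia.
  - have := nle_move n ac (_ : 0 < f c)%N; rewrite fa eqxx => /(_ _)/wrap[|]; first by lia.
    by lia.
  - by move=> b; rewrite /move; have := fB b; have [->|] := eqVneq b a; lia.
  - by rewrite sum_move //; lia.
apply: (IHj n.+1 _ k _ _ _ _ _ _ vw'); first by lia.
- by move=> b; rewrite /raise; have := nf b; lia.
- by rewrite -[k in (_ <= k)%N]card_ord max_card.
- by move=> b; rewrite /raise; have := fB b; have := nf b; lia.
- by apply: leq_ltn_trans fk; apply: leq_sum => b _; rewrite /raise; lia.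
Qed.

End Lower.

(** * The exact sequence *)

Section Exact.
Variables (K : numFieldType) (k N' B : nat).
Local Notation N := N'.+1.
Local Notation fkdim := (fdim (site k N')).
Local Notation Efam := (@mode_fam K k N' B).
Local Notation Mcyc := (@Mcyc K k N' B).
Local Notation ketf := (ket_fill K N').
Implicit Types (a b c : 'I_k) (l : 'I_B) (u v w : 'rV[K]_fkdim) (f g : 'I_k -> nat).

Hypothesis BN : (B.*2 < N)%N.

Lemma M_vac f w : vacuum f w -> (Mcyc w :=: Mcyc (ketf f))%MS.
Proof. by case=> c c0 ->; exact: cyc_scale. Qed.

Lemma rank_M f : (forall b, f b <= B)%N -> (\sum_b (B - f b) < k)%N ->
  \rank (Mcyc (ketf f)) = Pdim B f.
Proof.
move=> fB fk; apply/eqP; rewrite eqn_leq rank_M_le ?rank_M_ge //; try exact: vac_ketf.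
by lia.
Qed.

(** The upper bound is attained, so [vac_raise] applies at every level [l] and not only at the
    lowest one. *)
Lemma M_raise f l : (forall b, f b <= B)%N -> (\sum_b (B - f b) < k)%N ->
  (Mcyc (ketf (raise f l)) <= Mcyc (ketf f))%MS.
Proof.
move=> fB fk.
have [||w' vw' w'M] := vac_raise (B := B) (l := l) (vac_ketf K N' f).
- by rewrite -/(Mcyc (ketf f)) rank_M.
- by move=> a _; have := fB a; have := ltn_ord l; lia.
by rewrite -(M_vac vw') cyc_subc.
Qed.

Lemma hop_Efam a c q i : Efam i *m hop K N' a c q = hop K N' a c q *m Efam i.
Proof. by apply: hop_E; have := ltn_ord i; lia. Qed.

Section Hop.
Variables (f : 'I_k -> nat) (a c : 'I_k).
Hypotheses (fB : forall b, (f b <= B)%N) (fk : (\sum_b (B - f b) < k)%N).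
Hypotheses (fac : ((f a).+2 <= f c)%N) (gap : forall b, ((f b <= f a) || (f c <= f b))%N).
Let T := hop K N' a c ((f c).-1 - f a).

Let ac : a != c.
Proof. by apply: contraTneq fac => <-; lia. Qed.

Lemma vac_hop : vacuum (move f a c) (ketf f *m T).
Proof. by have := fB c => fcB; apply: hop_move (vac_ketf _ _ _) => //; lia. Qed.

Lemma M_hop : (Mcyc (ketf f) *m T :=: Mcyc (ketf (move f a c)))%MS.
Proof.
apply: eqmx_trans (M_vac vac_hop); apply: eqmx_sym; apply: cyc_comm => i.
exact: hop_Efam.
Qed.

(** The transport kills the raised vacuum, which gives one inclusion; equality follows since the
    three ranks satisfy [Pdim_gap]. *)
Lemma M_ker_hop : (Mcyc (ketf f) :&: kermx T :=: Mcyc (ketf (raise f (f a))))%MS.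
Proof.
have fcB := fB c; have faB : (f a < B)%N by lia.
have sub : (Mcyc (ketf (raise f (f a))) <= Mcyc (ketf f) :&: kermx T)%MS.
  rewrite sub_capmx (M_raise (Ordinal faB)) //=; apply/row_subP => r; apply/sub_kermxP.
  apply: (cyc_kill (E := Efam) (w := ketf (raise f (f a)))) (row_sub r _) => [i|]; first exact: hop_Efam.
  by apply: (hop_kill ac _ _ (vac_ketf _ _ _)); rewrite /raise leqnn; have := fac; case: leqP; lia.
apply/eqmxP/andP; split=> //; have := mxrank_leqif_sup sub => /leqifP; case: ifP => // _.
have Bm b : (move f a c b <= B)%N.
  by rewrite /move; have := fB b; have [->|] := eqVneq b a; lia.
have Br b : (raise f (f a) b <= B)%N.
  by rewrite /raise; have := fB b; have := gap b; lia.
have rk : (\sum_b (B - raise f (f a) b) < k)%N.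
  by apply: leq_ltn_trans fk; apply: leq_sum => b _; rewrite /raise; lia.
have := mxrank_mul_ker (Mcyc (ketf f)) T; rewrite M_hop.
rewrite (rank_M fB fk) (rank_M Br rk) (rank_M Bm); last by rewrite sum_move //; lia.
have := Pdim_gap (B := B) (f := f) (a := a) (c := c) _ gap.
by rewrite fac fcB => /(_ isT) ->; lia.
Qed.

End Hop.

End Exact.

(** * Embedding into the tensor power of F *)

From mathcomp Require Import finmap monalg.
From mathcomp Require Import classical_sets cardinality fsbigop reals complex.
Require Import Defs.

Section Linext.
Variables (K : fieldType) (V : lmodType K) (B : choiceType) (g : B -> V).

Lemma linext_sub (D : {fset B}) u : (msupp u `<=` D)%fset ->
  linext g u = \sum_(b <- D) u@_b *: g b.
Proof.
move=> uD; rewrite /linext; apply: big_fset_incl => // b _ bu.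
by rewrite mcoeff_outdom ?scale0r.
Qed.

Lemma linext_lin c u v : linext g (c *: u + v) = c *: linext g u + linext g v.
Proof.
pose D := (msupp u `|` msupp v)%fset.
have uD : (msupp u `<=` D)%fset by exact: fsubsetUl.
have vD : (msupp v `<=` D)%fset by exact: fsubsetUr.
rewrite (linext_sub uD) (linext_sub vD) (linext_sub (D := D)); last first.
  apply: fsubset_trans (msuppD_le _ _) _; rewrite fsubUset vD andbT.
  exact: fsubset_trans (msuppZ_le _ _) uD.
rewrite scaler_sumr -big_split; apply: eq_bigr => b _ /=.
by rewrite mcoeffD mcoeffZ scalerDl scalerA.
Qed.

Lemma linextU b : linext g << b >> = g b.
Proof. by rewrite /linext msuppU oner_eq0 big_seq_fset1 mcoeffUU scale1r. Qed.

Lemma linext0 : linext g 0 = 0.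
Proof. by rewrite /linext msupp0 big_nil. Qed.

Lemma linextZ c u : linext g (c *: u) = c *: linext g u.
Proof. by rewrite -[c *: u]addr0 linext_lin linext0 addr0. Qed.

Lemma linextD u v : linext g (u + v) = linext g u + linext g v.
Proof. by rewrite -[u]scale1r linext_lin !scale1r. Qed.

Lemma linext_sum (I : Type) (r : seq I) (P : pred I) (F : I -> {malg K[B]}) :
  linext g (\sum_(i <- r | P i) F i) = \sum_(i <- r | P i) linext g (F i).
Proof. exact: (big_morph _ linextD linext0). Qed.

End Linext.

Lemma rmulU (K : fieldType) p (S : state) : rmul p (<< S >> : F K) =
  if occupied S p then 0 else (-1) ^+ num_above S p *: << fill S p >>.
Proof. exact: linextU. Qed.

Lemma state_ext (S T : state) : (forall p, occupied S p = occupied T p) -> S = T.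
Proof. by move=> ST; apply/fsetP => p; move: (ST p); rewrite /occupied => /addbI. Qed.

(** * The modes of [F] inside a finite window of positions *)

Section Positions.
Variables (h N' : nat).
Local Notation B := (h.*2).
Local Notation N := N'.+1.

(** The window begins just above [- B]; as [B] is even, the shift exchanges parities. *)
Definition position (x : nat) : int := x%:Z + 1 - B%:Z.

Lemma pos_inj : injective position.
Proof. by move=> x y; rewrite /position; lia. Qed.

Definition based (S : state) := forall p : int, p <= - B%:Z -> occupied S p.

(** All positions up to [- B] are occupied, so a psi below the window gives zero, and a psi above it
    is paired with a phi below it. *)
Lemma eF_based (K : fieldType) n (S : state) : based S -> (n.*2 <= N)%N ->
  eF (n%:Z - B%:Z) (<< S >> : F K) =
  \sum_(y : 'I_N | odd y) \sum_(x : 'I_N | ~~ odd x && (x + y + 1 == n.*2)%N)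
    rmul (position x) (rmul (position y) << S >>).
Proof.
move=> bS nN; rewrite /eF.
(* For odd [y], the index i of the mode psi(i) sitting at [y]. *)
pose iy (y : 'I_N) : int := (y./2)%:Z + 1 - h%:Z.
pose r := [seq iy y | y <- enum [pred y : 'I_N | odd y]].
have iy_inj : {in enum [pred y : 'I_N | odd y] &, injective iy}.
  move=> y z; rewrite !mem_enum !inE /iy => oy oz e; apply: val_inj => /=; lia.
have occ0 p (u : F K) : (forall T, T \in msupp u -> based T) -> p <= - B%:Z -> rmul p u = 0.
  move=> bu pB; rewrite /rmul /linext big_seq big1 // => T Tu.
  by rewrite (bu T Tu p pB) scaler0.
have based_rmul p T : T \in msupp (rmul p (<< S >> : F K)) -> based T.
  case/msupp_rmul => S' [+ oS' ->]; rewrite msuppU oner_eq0 inE => /eqP eS q qB.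
  by rewrite eS in oS' *; rewrite occupied_fill // bS ?orbT.
have inr i : i \notin r -> phi ((n%:Z - B%:Z) - i) (psi i (<< S >> : F K)) = 0.
  move=> ir; have [iB|Bi] := lerP (2 * i) (- B%:Z).
    rewrite /psi (occ0 _ _ _ iB) /phi ?[rmul _ 0]linext0 // => T.
    by rewrite msuppU oner_eq0 inE => /eqP ->.
  rewrite /phi; apply: occ0 => [T|]; first exact: based_rmul.
  rewrite leNgt; apply: contra ir => iN.
  have yN : (absz (2 * i + B%:Z - 1)%R < N)%N by lia.
  apply/mapP; exists (Ordinal yN); first by rewrite mem_enum inE /=; lia.
  by rewrite /iy /=; lia.
rewrite (@fsbigE _ _ _ _ _ r) //; first last.
- by move=> i _; exact: inr.
- by rewrite map_inj_in_uniq ?enum_uniq.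
rewrite (eq_bigl predT) => [|i]; last by apply/mem_set.
rewrite big_map big_enum; apply: eq_bigr => y oy.
have yE : 2 * iy y = position y by rewrite /iy /position; move: oy; rewrite inE; lia.
rewrite /psi yE; have [yn|ny] := ltnP y n.*2; last first.
  rewrite big_pred0 => [|x]; last by lia.
  rewrite /phi; apply: occ0 => [T|]; first exact: based_rmul.
  by move: yE; rewrite /position; lia.
have xN : (n.*2 - y.+1 < N)%N by lia.
have xE : 2 * (n%:Z - B%:Z - iy y) + 1 = position (n.*2 - y.+1).
  by move: yE; rewrite /position; lia.
rewrite (big_pred1 (Ordinal xN)) => [|x]; first by rewrite /phi xE.
by rewrite /= -val_eqE /=; move: oy; rewrite inE; lia.
Qed.

End Positions.

(** * From the truncated space to the tensor power of [F] *)

Section Embedding.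
Variables (K : numFieldType) (k m h N' : nat).
Local Notation B := (h.*2).
Local Notation N := N'.+1.
Local Notation site := (site (k + m) N').
Local Notation fkdim := (fdim site).
Local Notation pos := (position h).
Local Notation Emode := (mode K (k + m) N').
Local Notation crea := (@creation K (k + m) N').
Local Notation pairop := (@pair_op K (k + m) N').
Local Notation ket := (@ket K site).
Local Notation rnk := (@rnk site).
Local Notation sg := (fsign K (@srk (k + m) N')).
Implicit Types (S : {set site}) (a b : 'I_k) (x y : 'I_N) (u v : 'rV[K]_fkdim).

Definition emb a : 'I_(k + m) := lshift m a.

(** Below the window everything is occupied, above it nothing. *)
Definition occ S a (p : int) : bool :=
  (p <= - B%:Z) || [exists x : 'I_N, (p == pos x) && ((emb a, x) \in S)].

Definition st S a : state := fset_set [set p : int | (p <= 0) (+) occ S a p]%classic.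

Lemma occupied_st S a p : occupied (st S a) p = occ S a p.
Proof.
rewrite /occupied /st in_fset_set ?mem_setE /=; last first.
  apply: sub_finite_set (finite_itv (- B%:Z) N%:Z) => q /=; rewrite /occ.
  case: existsP => [[x /andP[/eqP-> _]] _|_].
    by have := ltn_ord x; rewrite /pos; lia.
  by rewrite orbF; case: lerP; case: lerP => //=; lia.
by rewrite addbA addbb.
Qed.

Lemma occ_pos S a x : occ S a (pos x) = ((emb a, x) \in S).
Proof.
rewrite /occ (_ : _ <= _ = false) /=; last by rewrite /pos; lia.
apply/existsP/idP => [[y /andP[/eqP/pos_inj/val_inj-> //]]|xS].
by exists x; rewrite eqxx.
Qed.

Lemma based_st S a : based h (st S a).
Proof. by move=> p pB; rewrite occupied_st /occ pB. Qed.

Lemma fill_st S a x : (emb a, x) \notin S ->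
  fill (st S a) (pos x) = st ((emb a, x) |: S) a.
Proof.
move=> xS; apply: state_ext => p; rewrite occupied_fill ?occupied_st ?occ_pos // /occ.
case: (p <= - B%:Z); rewrite ?orbT //=; apply/orP/existsP => [[/eqP->|/existsP[y /andP[py yS]]]|].
- by exists x; rewrite eqxx setU11.
- by exists y; rewrite py inE yS orbT.
move=> [y /andP[/eqP-> ]]; rewrite !inE xpair_eqE eqxx /= => /orP[/eqP->|yS]; first by left.
by right; apply/existsP; exists y; rewrite eqxx.
Qed.

Lemma st_other S a (j : site) : j.1 != emb a -> st (j |: S) a = st S a.
Proof.
move=> ja; apply: state_ext => p; rewrite !occupied_st /occ; congr (_ || _).
apply: eq_existsb => x; rewrite !inE; have [e|//] := eqVneq (emb a, x) j.
by rewrite -e eqxx in ja.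
Qed.

Lemma num_above_st S a x :
  num_above (st S a) (pos x) = #|[set i in S | (i.1 == emb a) && (x < i.2)%N]|.
Proof.
pose A := [pred y : 'I_N | (x < y)%N && ((emb a, y) \in S)].
have -> : #|[set i in S | (i.1 == emb a) && (x < i.2)%N]| = #|A|.
  rewrite -(card_imset A (f := fun y => (emb a, y))) => [|y z [->] //].
  apply: eq_card => -[c y]; rewrite !inE /=.
  apply/andP/imsetP => [[yS /andP[/eqP ca xy]]|[z]].
    by rewrite ca in yS *; exists y => //; rewrite inE xy.
  by rewrite inE => /andP[xz zS] [-> ->]; rewrite zS eqxx.
rewrite /num_above.
have p_inj : injective (fun y : 'I_N => pos y) by move=> y z /pos_inj/val_inj.
rewrite (_ : fset_set _ = [fset pos (val y) | y in A]%fset); first by rewrite card_imfset //= -cardE.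
apply/fsetP => p; rewrite in_fset_set ?mem_setE /=; last exact: num_above_finite.
rewrite [LHS]unfold_in occupied_st /occ; apply/andP/imfsetP => [[xp]|[y]].
  rewrite (_ : _ <= _ = false) /=; last by move: xp; rewrite /pos; lia.
  case/existsP => y /andP[/eqP py yS]; exists y => //=.
  by rewrite !inE yS andbT; move: xp; rewrite py /pos; lia.
rewrite !inE /= => /andP[xy yS] ->; split; first by rewrite /pos; lia.
by apply/orP; right; apply/existsP; exists y; rewrite eqxx.
Qed.

(** Factors in later components count for the sign in the exterior algebra but not in the tensor
    product; they cancel for two modes in one component. *)
Definition above S (a : 'I_k) := #|[set i in S | (emb a < i.1)%N]|.

Lemma above_add S a x : above ((emb a, x) |: S) a = above S a.
Proof.
apply: eq_card => i; rewrite !inE; have [->|//] := eqVneq i (emb a, x).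
by rewrite ltnn !andbF.
Qed.

Lemma srk_lt (i j : site) : (srk i < srk j)%N = (i.1 < j.1)%N || ((j.1 == i.1) && (i.2 < j.2)%N).
Proof.
have iN := ltn_ord i.2; have jN := ltn_ord j.2; rewrite /srk -val_eqE /=.
have [ij|ji|->] := ltngtP i.1 j.1.
- by have : (i.1.+1 * N <= j.1 * N)%N; [rewrite leq_mul2r ij orbT|rewrite mulSn /=; lia].
- have : (j.1.+1 * N <= i.1 * N)%N; [by rewrite leq_mul2r ji orbT|rewrite mulSn /=].
  by move=> ?; apply/negbTE; rewrite -leqNgt; lia.
- by rewrite ltn_add2l.
Qed.

Lemma sgE S a x : sg (emb a, x) S = (-1) ^+ above S a * (-1) ^+ num_above (st S a) (pos x).
Proof.
rewrite num_above_st -exprD /fsign /above; congr (_ ^+ _).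
rewrite -cardsUI (_ : _ :&: _ = finset.set0) ?cards0 ?addn0; last first.
  apply/setP => i; rewrite !inE; case: eqP => [->|_]; last by rewrite !andbF.
  by rewrite ltnn andbF.
by apply: eq_card => i; rewrite !inE srk_lt /=; case: (i \in S).
Qed.

Lemma rmul_st S a x : rmul (pos x) (<< st S a >> : F K) =
  if (emb a, x) \in S then 0 else
    (-1) ^+ num_above (st S a) (pos x) *: << st ((emb a, x) |: S) a >>.
Proof.
rewrite rmulU occupied_st occ_pos; have [xS|xS] := boolP (_ \in S); first by [].
by rewrite fill_st.
Qed.

Definition stX S : {ffun 'I_k -> state} := [ffun a => st S a].

(** The spare components are forgotten; nothing is lost on [Pgood], where they are all equal to
    v(0). *)
Definition to_fock u : Fk K k := \sum_S u 0 (rnk S) *: << stX S >>.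

Lemma iota_lin c u v : to_fock (c *: u + v) = c *: to_fock u + to_fock v.
Proof.
rewrite /to_fock scaler_sumr -big_split; apply: eq_bigr => S _ /=.
by rewrite !mxE scalerDl scalerA.
Qed.

Lemma iota0 : to_fock 0 = 0.
Proof. by rewrite /to_fock big1 // => S _; rewrite mxE scale0r. Qed.

Lemma iotaZ c u : to_fock (c *: u) = c *: to_fock u.
Proof. by rewrite -[c *: u]addr0 iota_lin iota0 addr0. Qed.

Lemma iotaD u v : to_fock (u + v) = to_fock u + to_fock v.
Proof. by rewrite -[u]scale1r iota_lin !scale1r. Qed.

Lemma iota_sum (I : Type) (r : seq I) (P : pred I) (G : I -> 'rV[K]_fkdim) :
  to_fock (\sum_(i <- r | P i) G i) = \sum_(i <- r | P i) to_fock (G i).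
Proof. exact: (big_morph _ iotaD iota0). Qed.

Lemma iota_ket S : to_fock (ket S) = << stX S >>.
Proof.
rewrite /to_fock (bigD1 S) //= big1 => [|T TS].
  by rewrite addr0 mxE !eqxx scale1r.
by rewrite mxE eqxx (inj_eq (can_inj (@rnkK _))) (negPf TS) scale0r.
Qed.

Lemma row_ketE u : u = \sum_S u 0 (rnk S) *: ket S.
Proof.
rewrite {1}[u]row_sum_delta (reindex rnk) //=.
by exists (@stt _) => ? _; rewrite ?rnkK ?sttK.
Qed.

Definition upd (X : {ffun 'I_k -> state}) a (T : state) : {ffun 'I_k -> state} :=
  [ffun b => if b == a then T else X b].

Lemma rmulZ p c (u : F K) : rmul p (c *: u) = c *: rmul p u.
Proof. exact: linextZ. Qed.

Lemma iota_pair S a x y : x != y ->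
  to_fock (ket S *m pairop (emb a, x, y)) =
  linext (fun T => << upd (stX S) a T >> : Fk K k)
    (rmul (pos x) (rmul (pos y) (<< st S a >> : F K))).
Proof.
move=> xy; rewrite /pair_op /= mulmxA /creation ket_cre rmul_st.
case: ifP => yS; first by rewrite mul0mx iota0 /rmul !linext0.
rewrite -scalemxAl ket_cre iotaZ rmulZ rmul_st linextZ.
case: ifP => xS; first by rewrite iota0 linext0 !scaler0.
rewrite iotaZ linextZ linextU iota_ket !scalerA; congr (_ *: << _ >>); last first.
  apply/ffunP => b; rewrite !ffunE; case: eqP => [-> //|/eqP ba].
  by rewrite !st_other // (inj_eq (@lshift_inj _ _)) eq_sym.
by rewrite !sgE above_add mulrACA -expr2 sqrr_sign mul1r.
Qed.

Definition good_st S := [forall b : 'I_m, forall x : 'I_N, ((rshift k b, x) \in S) == (x < B)%N].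

(** A pair of height at most [B] has a position below [B], filled in every spare component: e_m
    kills v(0) for m at most 0. *)
Lemma pair_rshift S (b : 'I_m) x y : good_st S -> (ht (rshift k b, x, y) <= B)%N -> x != y ->
  good (rshift k b, x, y) -> ket S *m pairop (rshift k b, x, y) = 0.
Proof.
move=> gS hB xy /andP[/= ex oy]; rewrite /pair_op /= mulmxA /creation ket_cre.
have inS z : ((rshift k b, z) \in S) = (z < B)%N by apply/eqP; move/forallP/(_ b)/forallP: gS; apply.
rewrite inS; case: ifP => yB; first by rewrite mul0mx.
rewrite -scalemxAl ket_cre !inE inS xpair_eqE eqxx (negPf xy) /=.
by rewrite ifT ?scaler0 //; move: hB; rewrite /ht /=; lia.
Qed.

Lemma iota_E_ket S n : good_st S -> (n <= B)%N -> (n.*2 <= N)%N ->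
  to_fock (ket S *m Emode n) = e (n%:Z - B%:Z) << stX S >>.
Proof.
move=> gS nB nN; rewrite E_sum mulmx_sumr iota_sum big_mkcond triple_sum big_split_ord /=.
rewrite [X in _ + X]big1 ?addr0 => [|b _]; last first.
  rewrite big1 // => x _; rewrite big1 // => y _; case: ifP => // /andP[gt /eqP hn].
  rewrite pair_rshift ?iota0 ?hn //; apply: contraTneq gt => ->.
  by rewrite /good /=; case: odd.
rewrite /e; apply: eq_bigr => a _; rewrite /act_at linextU ffunE.
rewrite (eF_based (N' := N')) //; last exact: based_st.
rewrite linext_sum [RHS]big_mkcond /= exchange_big; apply: eq_bigr => y _ /=.
case: ifP => oy; last by rewrite big1 // => x _; rewrite /good /= oy andbF.
rewrite linext_sum [RHS]big_mkcond; apply: eq_bigr => x _.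
have -> : good (lshift m a, x, y) && (ht (lshift m a, x, y) == n) = ~~ odd x && (x + y + 1 == n.*2)%N.
  by rewrite /good /ht /= oy andbT; apply/andP/andP => -[ex xy]; split=> //; lia.
case: ifP => // /andP[ex _]; rewrite iota_pair //.
by apply: contraNneq ex => ->; rewrite oy.
Qed.

Definition Pgood : 'M[K]_fkdim := pj K (fun s => good_st (stt s)).

Lemma linpred_ket (P : 'rV[K]_fkdim -> Prop) u : linpred P -> (u <= Pgood)%MS ->
  (forall S, good_st S -> u 0 (rnk S) != 0 -> P (ket S)) -> P u.
Proof.
move=> linP /sub_pj ug PS; rewrite [u]row_ketE; elim/big_ind: _ => [|v v' Pv Pv'|S _].
- exact: linpred0 linP.
- by rewrite -[v]scale1r; apply: linpredD.
- have [->|uS] := eqVneq (u 0 (rnk S)) 0; first by rewrite scale0r; exact: linpred0 linP.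
  rewrite -[_ *: _]addr0; apply: (linpredD linP); last exact: linpred0 linP.
  by apply: PS => //; rewrite -[S](rnkK) ug.
Qed.

Lemma e_lin n c (u v : Fk K k) : e n (c *: u + v) = c *: e n u + e n v.
Proof. by rewrite /e scaler_sumr -big_split; apply: eq_bigr => a _; exact: linext_lin. Qed.

Lemma iota_E u n : (u <= Pgood)%MS -> (n <= B)%N -> (n.*2 <= N)%N ->
  to_fock (u *m Emode n) = e (n%:Z - B%:Z) (to_fock u).
Proof.
move=> ug nB nN.
apply: (linpred_ket (P := fun u => to_fock (u *m Emode n) = e (n%:Z - B%:Z) (to_fock u))) ug _.
  split=> [|c v v' ev ev'].
    by rewrite mul0mx iota0 /e big1 // => a _; exact: linext0.
  by rewrite mulmxDl -scalemxAl !iota_lin e_lin ev ev'.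
by move=> S gS _; rewrite iota_E_ket // iota_ket.
Qed.

Lemma good_add S a x : good_st ((emb a, x) |: S) = good_st S.
Proof.
apply: eq_forallb => b; apply: eq_forallb => y; rewrite !inE xpair_eqE.
by rewrite eq_rlshift.
Qed.

Lemma Pgood_ket S : good_st S -> (ket S <= Pgood)%MS.
Proof.
move=> gS; apply/sub_pj => s; rewrite mxE eqxx /=.
by case: (s =P rnk S) => [-> _|_]; rewrite ?rnkK // eqxx.
Qed.

Lemma Pgood_E u n : (u <= Pgood)%MS -> (n <= B)%N -> (u *m Emode n <= Pgood)%MS.
Proof.
move=> ug nB; apply: (linpred_ket (P := fun u => (u *m Emode n <= Pgood)%MS)) ug _.
  exact: linpred_mul.
move=> S gS _; rewrite E_sum mulmx_sumr; apply: summx_sub => -[[c x] y] /andP[gt /eqP hn].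
have [a ca|b cb] := split_ordP c; last first.
  rewrite cb in gt hn *; rewrite pair_rshift ?sub0mx ?hn //; apply: contraTneq gt => ->.
  by rewrite /good /=; case: odd.
rewrite ca /pair_op /= mulmxA /creation ket_cre; case: ifP => _; first by rewrite mul0mx sub0mx.
rewrite -scalemxAl ket_cre; case: ifP => _; first by rewrite scaler0 sub0mx.
by rewrite !scalemx_sub // Pgood_ket // !good_add.
Qed.

Lemma stX_inj S S' : good_st S -> good_st S' -> stX S = stX S' -> S = S'.
Proof.
move=> gS gS' SS'; apply/setP => -[c x]; have [a|b] := split_ordP c => ->.
  by have := congr1 (fun X : {ffun 'I_k -> state} => occupied (X a) (pos x)) SS'; rewrite /= !ffunE !occupied_st !occ_pos.
have gE T : good_st T -> ((rshift k b, x) \in T) = (x < B)%N.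
  by move=> gT; apply/eqP; move/forallP/(_ b)/forallP: gT; apply.
by rewrite !gE.
Qed.

Lemma iota_inj u : (u <= Pgood)%MS -> to_fock u = 0 -> u = 0.
Proof.
move=> /sub_pj ug iu; apply/rowP => s; rewrite mxE -[s]sttK.
set S := stt s; apply/eqP; apply: contraT => uS.
have gS : good_st S by rewrite -[S]rnkK ug.
have /eqP := congr1 (mcoeff (stX S)) iu; rewrite mcoeff0 /to_fock raddf_sum /= (bigD1 S) //= big1.
  by rewrite addr0 mcoeffZ mcoeffUU mulr1 (negPf uS).
move=> T TS; rewrite mcoeffZ mcoeffU.
have [->|uT] := eqVneq (u 0 (rnk T)) 0; first by rewrite mul0r.
case: eqP => [e|_]; last by rewrite mulr0.
by move/eqP: TS; case; apply: stX_inj => //; rewrite -[T]rnkK ug.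
Qed.

End Embedding.

(** * Weights *)

Section Span.
Variables (K : fieldType) (V : lmodType K) (A : set V).

Lemma lspan0 : lspan A 0.
Proof. by exists 0%N, (fun=> 0), (fun=> 0); split=> [[]//|]; rewrite big_ord0. Qed.

Lemma lspan_id v : A v -> lspan A v.
Proof. by move=> Av; exists 1%N, (fun=> 1), (fun=> v); split=> //; rewrite big_ord1 scale1r. Qed.

Lemma lspan_lin c u v : lspan A u -> lspan A v -> lspan A (c *: u + v).
Proof.
move=> [n [cu [uu [Au ->]]]] [n' [cv [vv [Av ->]]]].
exists (n + n')%N, (fun i => match fintype.split i with inl j => c * cu j | inr j => cv j end),
  (fun i => match fintype.split i with inl j => uu j | inr j => vv j end); split.
  by move=> i; case: (fintype.split i).
rewrite big_split_ord scaler_sumr; congr (_ + _); apply: eq_bigr => j _.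
  by rewrite (unsplitK (inl j)) scalerA.
by rewrite (unsplitK (inr j)).
Qed.

Lemma lspan_ind (P : V -> Prop) : P 0 -> (forall c u v, P u -> P v -> P (c *: u + v)) ->
  (forall u, A u -> P u) -> forall u, lspan A u -> P u.
Proof.
move=> P0 PD PA _ [n [c [u [Au ->]]]]; elim/big_ind: _ => // [x y Px Py|i _].
  by rewrite -[x]scale1r; exact: PD.
by rewrite -[_ *: _]addr0; apply: PD => //; exact: PA.
Qed.

End Span.

(** * The modules as cyclic subspaces, and their weight spaces *)

Section Fillings.
Variables (K : numFieldType) (k m h N' : nat).
Local Notation B := (h.*2).
Local Notation N := N'.+1.
Local Notation site := (site (k + m) N').
Local Notation fkdim := (fdim site).
Local Notation pos := (position h).
Local Notation Emode := (mode K (k + m) N').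
Local Notation Efam := (@mode_fam K (k + m) N' B).
Local Notation Mcyc := (@Mcyc K (k + m) N' B).
Local Notation pairop := (@pair_op K (k + m) N').
Local Notation ket := (@ket K site).
Local Notation ketf := (@ket_fill K (k + m) N').
Local Notation rnk := (@rnk site).
Local Notation st := (@st k m h N').
Local Notation stX := (@stX k m h N').
Local Notation iota_fk := (@to_fock K k m h N').
Local Notation Pgood := (Pgood K k m h N').
Local Notation hop := (hop K N').
Implicit Types (S : {set site}) (a b : 'I_k) (x y : 'I_N) (u v : 'rV[K]_fkdim).

Hypothesis BN : (B.*2 < N)%N.

(* The components beyond the first [k] are filled up to [B], that is to v(0): they only serve
   as the spare components of the lower bound. *)
Definition fD (D : {ffun 'I_k.+1 -> nat}) (r : nat) (c : 'I_(k + m)) : nat :=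
  match fintype.split c with inl a => (B - (beta D a + 2 * r))%N | inr _ => B end.

Lemma fD_lshift D r a : fD D r (lshift m a) = (B - (beta D a + 2 * r))%N.
Proof. by rewrite /fD (unsplitK (inl a)). Qed.

Lemma fD_rshift D r (b : 'I_m) : fD D r (rshift k b) = B.
Proof. by rewrite /fD (unsplitK (inr b)). Qed.

Definition sea (f : 'I_(k + m) -> nat) : {set site} := [set j : site | (j.2 < f j.1)%N]%SET.

Section Module.
Variables (D : {ffun 'I_k.+1 -> nat}) (r : nat).
Hypothesis Dr : (total D + 2 * r <= B)%N.

Lemma beta_total a : (beta D a <= total D)%N.
Proof. by rewrite /beta /total big_mkcond; apply: leq_sum => j _; case: ifP. Qed.

Lemma fD_le c : (fD D r c <= B)%N.
Proof. by rewrite /fD; case: fintype.split => // a; lia. Qed.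

Lemma fD_ge c : (B - (total D + 2 * r) <= fD D r c)%N.
Proof. by rewrite /fD; case: fintype.split => [a|_]; [have := beta_total a|]; lia. Qed.

Lemma good_sea : good_st h (sea (fD D r)).
Proof. by apply/forallP => b; apply/forallP => x; rewrite inE /= fD_rshift. Qed.

Lemma st_sea a : st (sea (fD D r)) a = vac (- (beta D a)%:Z - (2 * r)%N%:Z).
Proof.
have bt := beta_total a; apply: state_ext => p; rewrite occupied_st occupied_vac /occ.
apply/orP/idP => [[|/existsP[x /andP[/eqP -> ]]]|pb].
- by lia.
- by rewrite inE /= /emb fD_lshift /position; lia.
- have [pB|Bp] := lerP p (- B%:Z); [by left|right].
  have xN : (absz (p + B%:Z - 1)%R < N)%N by lia.
  apply/existsP; exists (Ordinal xN); rewrite inE /= /emb fD_lshift /position /=.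
  by apply/andP; split; [apply/eqP|]; lia.
Qed.

Lemma iota_ketf : iota_fk (ketf (fD D r)) = w D K r.
Proof.
rewrite /ket_fill iota_ket /w; congr << _ >>; apply/ffunP => a; rewrite !ffunE.
exact: st_sea.
Qed.

Lemma Mcyc_good : (Mcyc (ketf (fD D r)) <= Pgood)%MS.
Proof.
apply: cyc_sub => [|i u ug]; first by apply: Pgood_ket; exact: good_sea.
by apply: Pgood_E => //; exact: ltn_ord.
Qed.

(** Both sides are generated by modes from the same vacuum. [Efam] has a longer range of indices,
    but its additional modes, of index at most [- (total D + 2 * r)], kill that vacuum. *)
Lemma M_iota (v : Fk K k) : Defs.M D r v <-> exists2 u, (u <= Mcyc (ketf (fD D r)))%MS & v = iota_fk u.
Proof.
split.
  move: v; apply: (lspan_ind (P := fun v : Fk K k => exists2 u, (u <= Mcyc (ketf (fD D r)))%MS & v = iota_fk u)).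
  - by exists 0; rewrite ?sub0mx ?iota0.
  - move=> c _ _ [u uM ->] [u' uM' ->]; exists (c *: u + u'); last by rewrite iota_lin.
    by rewrite addmx_sub // scalemx_sub.
  - move=> _ [ms + ->]; elim: ms => [_|n ms IH].
      by exists (ketf (fD D r)); rewrite ?cyc_id ?iota_ketf.
    move=> /andP[nr /IH[u uM /= ->]].
    have iB : ((absz (n + B%:Z)%R).-1 < B)%N by lia.
    exists (u *m Efam (Ordinal iB)); first exact: cyc_stable.
    have ug : (u <= Pgood)%MS by exact: submx_trans Mcyc_good.
    set q := absz (n + B%:Z)%R in iB *.
    have qE : q%:Z - B%:Z = n by rewrite /q; lia.
    have -> : Efam (Ordinal iB) = Emode q by rewrite /mode_fam /= prednK // /q; lia.
    by rewrite (iota_E ug) ?qE //; rewrite /q; lia.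
move=> [u uM ->]; apply: (cyc_ind (P := fun u => Defs.M D r (iota_fk u))) uM.
- split=> [|c u1 u2 H1 H2]; first by rewrite iota0; exact: lspan0.
  by rewrite iota_lin; exact: lspan_lin.
- by rewrite iota_ketf; apply: lspan_id; exists [::].
move=> i {}u uM Mu; have iB := ltn_ord i.
(* For the additional modes, [i.+1] is at most every filling, whereas a fresh pair has height above
   the filling of its component. *)
have [il|li] := leqP (B - (total D + 2 * r)) i; last first.
  rewrite (cyc_kill (E := Efam) (w := ketf (fD D r)) (T := Efam i) _ _ uM) => [|i'|].
  - by rewrite iota0; exact: lspan0.
  - exact: oper_comm.
  - rewrite /mode_fam /mode (fresh_kill (c' := fun=> 0) (vac_ketf K N' (fD D r))).
      by rewrite /quad_op mulmx_sumr big1 // => t _; rewrite scale0r mulmx0.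
    move=> t gt ft; rewrite (fresh_ht gt ft); case: eqP => // e1.
    by have := fD_ge t.1.1; lia.
have ug : (u <= Pgood)%MS by exact: submx_trans Mcyc_good.
have iN : (i.+1.*2 <= N)%N by lia.
rewrite (iota_E ug iB iN).
apply: (lspan_ind (P := fun v : Fk K k => Defs.M D r (e (i.+1%:Z - B%:Z) v))) Mu.
- by rewrite /e big1 => [|a _]; [exact: lspan0|exact: linext0].
- by move=> c v1 v2 H1 H2; rewrite e_lin; exact: lspan_lin.
- move=> _ [ms msr ->]; apply: lspan_id; exists (i.+1%:Z - B%:Z :: ms) => //=.
  by rewrite msr andbT; lia.
Qed.

End Module.

Lemma sub_pjE (P : pred 'I_fkdim) u : (u <= pj K P)%MS -> u *m pj K P = u.
Proof.
move=> /sub_pj uP; apply/rowP => s; rewrite pjE; have := uP s.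
by case: (P s); rewrite ?mulr1 // mulr0; case: eqP => [-> //|_ /(_ isT)].
Qed.

Definition wd S : int := \sum_(a < k) energy (st S a).
Definition wh S : int := \sum_(a < k) charge (st S a).

Lemma wd_add S a x : (emb m a, x) \notin S ->
  wd ((emb m a, x) |: S) = wd S + (pos x %/ 2)%Z.
Proof.
move=> xS; rewrite /wd (bigD1 a) //= [in RHS](bigD1 a) //= -fill_st //.
rewrite energy_fill ?occupied_st ?occ_pos // addrAC; congr (_ + _ + _).
by apply: eq_bigr => b ba; rewrite st_other // (inj_eq (@lshift_inj _ _)) eq_sym.
Qed.

Lemma wh_add S a x : (emb m a, x) \notin S -> wh ((emb m a, x) |: S) = wh S + 1.
Proof.
move=> xS; rewrite /wh (bigD1 a) //= [in RHS](bigD1 a) //= -fill_st //.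
rewrite charge_fill ?occupied_st ?occ_pos // addrAC; congr (_ + _ + _).
by apply: eq_bigr => b ba; rewrite st_other // (inj_eq (@lshift_inj _ _)) eq_sym.
Qed.

Definition weighs (qa qb : rat) S := ((wd S)%:~R == qa) && ((wh S)%:~R / 2 == qb).

Definition PW (qa qb : rat) : 'M[K]_fkdim := pj K (fun s => weighs qa qb (stt s)).

Lemma ket_PW S qa qb : ket S *m PW qa qb = if weighs qa qb S then ket S else 0.
Proof.
apply/rowP => s; rewrite pjE; have [->|/negPf sS] := eqVneq s (rnk S).
  by rewrite rnkK; case: ifP => _; rewrite !mxE ?eqxx ?mulr1 ?mulr0.
by case: ifP => _; rewrite !mxE ?eqxx ?sS ?mul0r.
Qed.

(** Each pair of [mode n] adds [n - B] to the energy and 2 to the charge. *)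
Lemma E_PW u n qa qb : (u <= Pgood)%MS -> (n <= B)%N ->
  u *m Emode n *m PW qa qb = u *m PW (qa - (n%:Z - B%:Z)%:~R) (qb - 1) *m Emode n.
Proof.
move=> ug nB.
apply: (linpred_ket (P := fun u => u *m Emode n *m PW qa qb =
  u *m PW (qa - (n%:Z - B%:Z)%:~R) (qb - 1) *m Emode n)) ug _.
  split=> [|c v v' ev ev']; first by rewrite !mul0mx.
  by rewrite !mulmxDl -!scalemxAl ev ev'.
move=> S gS _; rewrite ket_PW (_ : (if _ then _ else _) *m _ =
    if weighs (qa - (n%:Z - B%:Z)%:~R) (qb - 1) S then ket S *m Emode n else 0); last first.
  by case: ifP => _; rewrite ?mul0mx.
rewrite E_sum !mulmx_sumr mulmx_suml.
have -> : (if weighs (qa - (n%:Z - B%:Z)%:~R) (qb - 1) S then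
    \sum_(t | good t && (ht t == n)) ket S *m pairop t else 0) =
  \sum_(t | good t && (ht t == n))
    if weighs (qa - (n%:Z - B%:Z)%:~R) (qb - 1) S then ket S *m pairop t else 0.
  by case: ifP => _ //; rewrite big1.
apply: eq_bigr => -[[c x] y] /andP[gt /eqP hn].
have [a ca|b cb] := split_ordP c; last first.
  rewrite cb in gt hn *; rewrite (pair_rshift K gS) ?hn //.
    by rewrite mul0mx if_same.
  by apply: contraTneq gt => ->; rewrite /good /=; case: odd.
have xy : x != y by apply: contraTneq gt => ->; rewrite /good /=; case: odd.
rewrite ca /pair_op /= mulmxA /creation ket_cre; case: ifP => yS; first by rewrite !mul0mx if_same.
rewrite -scalemxAl ket_cre; case: ifP => xS; first by rewrite scaler0 mul0mx if_same.
rewrite -!scalemxAl ket_PW.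
have -> : weighs qa qb ((lshift m a, x) |: ((lshift m a, y) |: S)) =
    weighs (qa - (n%:Z - B%:Z)%:~R) (qb - 1) S.
  rewrite /weighs !wd_add ?wh_add ?yS ?xS //.
  have -> : wd S + (pos y %/ 2)%Z + (pos x %/ 2)%Z = wd S + (n%:Z - B%:Z).
    by rewrite -hn /ht /position /=; move/andP: gt => /= [ex oy]; lia.
  rewrite !rmorphD /= !mulrDl; congr (_ && _).
    by apply/eqP/eqP => [<-|->]; ring.
  by apply/eqP/eqP => [<-|e1]; [field|rewrite e1; field].
by case: ifP; rewrite ?scaler0.
Qed.

Lemma M_PW f u qa qb : (Mcyc (ketf f) <= Pgood)%MS ->
  (u <= Mcyc (ketf f))%MS -> (u *m PW qa qb <= Mcyc (ketf f))%MS.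
Proof.
move=> fg uM; move: qa qb.
apply: (cyc_ind (P := fun u => forall qa qb, (u *m PW qa qb <= Mcyc (ketf f))%MS)) uM.
- by do 2 apply: linpred_all => ?; exact: linpred_mul.
- by move=> qa qb; rewrite ket_PW; case: ifP; rewrite ?sub0mx ?cyc_id.
- move=> i {}u uM IH qa qb; rewrite E_PW ?(submx_trans uM) //.
  by apply: (cyc_stable (E := Efam)); exact: IH.
Qed.

Section Weighted.
Variables (f : 'I_(k + m) -> nat) (a c : 'I_(k + m)) (sh : rat).
Hypotheses (fB : forall b : 'I_(k + m), (f b <= B)%N) (fk : (\sum_b (B - f b) < k + m)%N).
Hypotheses (fac : ((f a).+2 <= f c)%N) (gap : forall b : 'I_(k + m), ((f b <= f a) || (f c <= f b))%N).
Let T := hop a c ((f c).-1 - f a).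
Let f1 := raise f (f a).
Let f2 := move f a c.
Hypotheses (good0 : (Mcyc (ketf f) <= Pgood)%MS) (good1 : (Mcyc (ketf f1) <= Pgood)%MS)
  (good2 : (Mcyc (ketf f2) <= Pgood)%MS).
Hypothesis wdE : (wd (sea f))%:~R = (wd (sea f2))%:~R + sh.
Hypothesis whE : wh (sea f) = wh (sea f2).

(** The transport shifts the weight of the vacuum by [sh]; commuting with the modes, it shifts all
    weights of the module alike. *)
Lemma hop_PW u qa qb : (u <= Mcyc (ketf f))%MS ->
  u *m PW qa qb *m T = u *m T *m PW (qa - sh) qb.
Proof.
move=> uM; move: qa qb.
apply: (cyc_ind (P := fun u => forall qa qb, u *m PW qa qb *m T = u *m T *m PW (qa - sh) qb)) uM.
- do 2 apply: linpred_all => ?; split=> [|d v v' ev ev']; first by rewrite !mul0mx.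
  by rewrite !mulmxDl -!scalemxAl ev ev'.
- move=> qa qb; have [d _ dE] := vac_hop K BN fB fk fac.
  rewrite dE -scalemxAl !ket_PW -/(sea f) -/(sea f2).
  have -> : weighs (qa - sh) qb (sea f2) = weighs qa qb (sea f).
    rewrite /weighs wdE whE; congr (_ && _).
    by apply/eqP/eqP => [->|<-]; ring.
  by case: ifP => _; rewrite ?mul0mx ?scaler0.
- move=> i {}u uM IH qa qb; have iB := ltn_ord i.
  have ET : Efam i *m T = T *m Efam i by exact: hop_Efam.
  have uT : (u *m T <= Pgood)%MS.
    by apply: submx_trans good2; rewrite -(M_hop K BN fB fk fac) submxMr.
  rewrite (E_PW _ _ (submx_trans uM good0) iB) -/(Efam i) -(mulmxA _ _ T) ET mulmxA IH.
  rewrite -[in RHS](mulmxA u) ET [in RHS]mulmxA (E_PW _ _ uT iB) -/(Efam i).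
  by rewrite (addrAC qa).
Qed.

(** The exact sequence of [M_hop] and [M_ker_hop] on a weight space; it stays surjective because
    [PW] preserves the module. *)
Lemma rank_PW qa qb :
  \rank (Mcyc (ketf f) :&: PW qa qb)%MS =
  (\rank (Mcyc (ketf f1) :&: PW qa qb)%MS + \rank (Mcyc (ketf f2) :&: PW (qa - sh) qb)%MS)%N.
Proof.
rewrite -(mxrank_mul_ker _ T) addnC; congr (_ + _)%N.
  apply: eqmx_rank; rewrite -capmxA (capmxC (PW _ _)) capmxA.
  by apply/eqmxP; apply: cap_eqmx => //; exact: M_ker_hop.
apply: eqmx_rank; apply/andP; split; apply/row_subP => r.
  rewrite row_mul; have := row_sub r (Mcyc (ketf f) :&: PW qa qb)%MS.
  move: (row _ _) => u; rewrite sub_capmx => /andP[uM uW].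
  have uE : u *m PW qa qb = u by apply: sub_pjE.
  rewrite sub_capmx -(M_hop K BN fB fk fac) submxMr //=.
  by rewrite -uE hop_PW // submxMl.
have := row_sub r (Mcyc (ketf f2) :&: PW (qa - sh) qb)%MS.
move: (row _ _) => v; rewrite sub_capmx -(M_hop K BN fB fk fac).
move=> /andP[/submxP[d ->] vW].
have <- := sub_pjE vW; rewrite -!(mulmxA d) ?mulmxA.
move: (submxMl d (Mcyc (ketf f))); move: (d *m _) => u uM.
rewrite -hop_PW // submxMr // sub_capmx M_PW //=; exact: submxMl.
Qed.

End Weighted.

Definition diag_wt (g : {set site} -> int) : 'M[K]_fkdim :=
  diag_mx (\row_s (g (stt s))%:~R).

Lemma diag_wtE u g s : (u *m diag_wt g) 0 s = u 0 s * (g (stt s))%:~R.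
Proof. by rewrite mul_mx_diag !mxE. Qed.

Lemma linext_iota (g : {ffun 'I_k -> state} -> int) u :
  linext (fun X => (g X)%:~R *: << X >>) (iota_fk u) = iota_fk (u *m diag_wt (g \o stX)).
Proof.
rewrite /to_fock linext_sum; apply: eq_bigr => S _.
by rewrite linextZ linextU scalerA diag_wtE rnkK.
Qed.

Lemma d_op_iota u : d_op (iota_fk u) = iota_fk (u *m diag_wt wd).
Proof.
rewrite /d_op linext_iota; congr (to_fock _ (_ *m diag_mx _)); apply/rowP => s.
by rewrite !mxE /= /wd; congr (_%:~R); apply: eq_bigr => a _; rewrite ffunE.
Qed.

Lemma h0_op_iota u : h0_op (iota_fk u) = iota_fk (u *m diag_wt wh).
Proof.
rewrite /h0_op linext_iota; congr (to_fock _ (_ *m diag_mx _)); apply/rowP => s.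
by rewrite !mxE /= /wh; congr (_%:~R); apply: eq_bigr => a _; rewrite ffunE.
Qed.

Lemma weighsE (qa qb : rat) S : weighs qa qb S =
  ((wd S)%:~R == ratr qa :> K) && (2^-1 * (wh S)%:~R == ratr qb :> K).
Proof.
rewrite /weighs -(inj_eq (fmorph_inj (@ratr K))) -(inj_eq (fmorph_inj (@ratr K)) _ qb).
by rewrite /= fmorph_div /= !ratr_int ratr_nat [in RHS]mulrC.
Qed.

Lemma diag_eigen u g c : (u *m diag_wt g = c *: u) <-> forall s, u 0 s != 0 -> (g (stt s))%:~R = c.
Proof.
split=> [/rowP ug s us|ug].
  by have := ug s; rewrite diag_wtE mxE mulrC; apply: mulIf.
apply/rowP => s; rewrite diag_wtE mxE mulrC.
by have [->|/ug ->] := eqVneq (u 0 s) 0; rewrite ?mulr0.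
Qed.

Lemma sub_PW u qa qb : (u <= PW qa qb)%MS <->
  u *m diag_wt wd = ratr qa *: u /\ 2^-1 *: (u *m diag_wt wh) = ratr qb *: u.
Proof.
have h0E : (2^-1 *: (u *m diag_wt wh) = ratr qb *: u) <-> (u *m diag_wt wh = (2 * ratr qb) *: u).
  split=> [e1|->]; last by rewrite scalerA mulrA mulVf ?mul1r // pnatr_eq0.
  by rewrite -scalerA -e1 scalerA mulfV ?scale1r // pnatr_eq0.
have hE z : (2^-1 * z == ratr qb :> K) = (z == 2 * ratr qb).
  by rewrite -(inj_eq (mulfI (_ : 2 != 0 :> K))) ?pnatr_eq0 // mulrA mulfV ?mul1r // pnatr_eq0.
rewrite h0E !diag_eigen; split=> [/sub_pj uP|[ud uh]].
  by split=> s /uP; rewrite weighsE hE => /andP[/eqP e1 /eqP e2].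
by apply/sub_pj => s us; rewrite weighsE hE ud ?uh // !eqxx.
Qed.

Lemma weight_iota D r u qa qb : (total D + 2 * r <= B)%N -> (u <= Mcyc (ketf (fD D r)))%MS ->
  weight_space (Defs.M D r) qa qb (iota_fk u) <-> (u <= PW qa qb)%MS.
Proof.
move=> Dr uM; have ug := submx_trans uM (Mcyc_good D r).
have subg v1 v2 : (v1 <= Pgood)%MS -> (v2 <= Pgood)%MS -> iota_fk v1 = iota_fk v2 -> v1 = v2.
  move=> g1 g2 e12; apply/eqP; rewrite -subr_eq0; apply/eqP; apply: (iota_inj (h := h)).
    by apply: addmx_sub => //; rewrite -scaleN1r scalemx_sub.
  by rewrite -scaleN1r addrC iota_lin scaleN1r e12 addNr.
have diag_good g : (u *m diag_wt g <= Pgood)%MS.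
  move/sub_pj: ug => ug; apply/sub_pj => s; rewrite diag_wtE mulf_eq0 negb_or => /andP[us _].
  exact: ug.
rewrite sub_PW /weight_space /= d_op_iota h0_op_iota -!iotaZ; split=> [[_ ed eh]|[-> ->]].
  split; first by apply: (subg _ _ (diag_good wd) _ ed); exact: scalemx_sub.
  apply: (subg _ _ _ _ eh); apply: scalemx_sub; [exact: (diag_good wh)|exact: ug].
by split=> //; apply/(M_iota Dr); exists u.
Qed.

Lemma has_dim_weight D r qa qb : (total D + 2 * r <= B)%N ->
  has_dim (weight_space (@Defs.M k D K r) qa qb)
    (\rank (Mcyc (ketf (fD D r)) :&: PW qa qb)%MS).
Proof.
move=> Dr; set A := (_ :&: _)%MS; pose rb := row_base A.
have rbA i : (row i rb <= A)%MS by rewrite -(eq_row_base A) row_sub.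
have sumE (d : 'I_(\rank A) -> K) :
    \sum_i d i *: iota_fk (row i rb) = iota_fk ((\row_i d i) *m rb).
  rewrite mulmx_sum_row iota_sum; apply: eq_bigr => i _.
  by rewrite iotaZ mxE.
exists (fun i => iota_fk (row i rb)); split.
- move=> i; have := rbA i; rewrite sub_capmx => /andP[uM uW].
  exact/(weight_iota _ _ Dr uM).
- move=> d; rewrite sumE => /iota_inj d0.
  have /eqP : (\row_i d i) *m rb = 0.
    apply: d0; apply: submx_trans (submxMl _ _) _.
    rewrite (eq_row_base A) /A; apply: submx_trans (capmxSl _ _) _; exact: Mcyc_good.
  rewrite mulmx_free_eq0 ?row_base_free // => /eqP/rowP d0' i.
  by have := d0' i; rewrite !mxE.
- move=> v Wv; have [Mv _ _] := Wv; have [u uM vE] := (M_iota Dr v).1 Mv.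
  rewrite vE in Wv *; have uW := (weight_iota _ _ Dr uM).1 Wv.
  have : (u <= rb)%MS by rewrite (eq_row_base A) sub_capmx uM.
  move=> /submxP[d ->]; exists (fun i => d 0 i); rewrite sumE; congr (iota_fk (_ *m _)).
  by apply/rowP => i; rewrite mxE.
Qed.

End Fillings.

(** * Weights of vacua, stabilisation of the chain, and the theorem *)

Lemma vac0 : vac 0 = fset0.
Proof. by apply: state_ext => p; rewrite occupied_vac /occupied inE addbF. Qed.

Lemma fill_vac (n : nat) : fill (vac (- n.+1%:Z)) (- n%:Z) = vac (- n%:Z).
Proof.
apply: state_ext => p; rewrite occupied_fill occupied_vac; last by lia.
by rewrite occupied_vac; lia.
Qed.

Lemma charge_vac (n : nat) : charge (vac (- n%:Z)) = - n%:Z.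
Proof.
elim: n => [|n IH]; first by rewrite oppr0 vac0 /charge big_seq_fset0.
have := charge_fill (S := vac (- n.+1%:Z)) (p := - n%:Z); rewrite fill_vac IH occupied_vac.
by move=> /(_ _)/wrap[|]; lia.
Qed.

(** The energy of v(-n) is the integer part of n^2/4; the remainder [odd n] is the source of the
    parities in the exponent. *)
Lemma energy_vac (n : nat) : 4 * energy (vac (- n%:Z)) + (odd n)%:Z = (n * n)%N%:Z.
Proof.
elim: n => [|n IH]; first by rewrite oppr0 vac0 /energy big_seq_fset0.
have := energy_fill (S := vac (- n.+1%:Z)) (p := - n%:Z); rewrite fill_vac occupied_vac.
by move=> /(_ _)/wrap[|]; lia.
Qed.

Section Chain.
Variables (K : numFieldType) (k : nat).
Implicit Types (D : {ffun 'I_k.+1 -> nat}).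

Lemma sum_fD_lt D r h m : (k * h.*2 < m)%N ->
  (\sum_(b < k + m) (h.*2 - fD h D r b) < k + m)%N.
Proof.
move=> km; rewrite big_split_ord /= [X in (_ + X)%N]big1 => [|b _]; last by rewrite fD_rshift subnn.
rewrite addn0 (@leq_ltn_trans (k * h.*2)%N) //; last by lia.
by rewrite -[X in (_ <= X * _)%N]card_ord -sum_nat_const leq_sum // => a _; lia.
Qed.

(** In the filling for [r.+1], raising at level [B.-1] affects exactly the first [k] components and
    yields the filling for [r], so [M_raise] gives the inclusion. *)
Lemma M_chain D r (v : Fk K k) : Defs.M D r v -> Defs.M D r.+1 v.
Proof.
pose h := (total D + 2 * r.+1)%N; pose m := (k * h.*2).+1; pose N' := h.*2.*2.
have BN : (h.*2.*2 < N'.+1)%N by [].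
have Dr : (total D + 2 * r <= h.*2)%N by lia.
have Dr1 : (total D + 2 * r.+1 <= h.*2)%N by lia.
move=> /(@M_iota K k m h N' BN _ _ Dr)[u uM ->]; apply/(@M_iota K k m h N' BN _ _ Dr1).
exists u => //; apply: submx_trans uM _.
have lB : (h.*2.-1 < h.*2)%N by lia.
have -> : fD h D r = raise (fD h D r.+1) (Ordinal lB) :> ('I_(k + m) -> nat).
  apply/funext => c; rewrite /raise /=; have [a ->|b ->] := split_ordP c.
    by rewrite !fD_lshift; have := beta_total D a; lia.
  by rewrite !fD_rshift; lia.
apply: M_raise => //; first exact: fD_le.
by apply: sum_fD_lt.
Qed.

Lemma M_chain_le D r r' (v : Fk K k) : (r <= r')%N -> Defs.M D r v -> Defs.M D r' v.
Proof. by move=> /subnK <-; elim: (r' - r)%N => // i IH Mv; rewrite addSn; apply: M_chain; exact: IH. Qed.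

(** A finite basis of the weight space of the union already lies in one term of the chain. *)
Lemma ch_L D (a b : rat) : exists r0, forall r, (r0 <= r)%N ->
  ch (L D K) a b = dim (weight_space (@Defs.M k D K r) a b).
Proof.
have [n [bs [bsL _ bsgen]]] := weight_has_dim (L D K) a b.
have /choice[ri riM] : forall i, exists r, (1 <= r)%N /\ Defs.M D r (bs i).
  by move=> i; have [[r r1 Mr] _ _] := bsL i; exists r.
exists (\max_i ri i).+1 => r r0r; rewrite /ch; congr dim; apply/seteqP; split=> v.
  move=> Wv; have [c vE] := bsgen v Wv; case: (Wv) => _ vd vh; split=> //.
  rewrite vE; elim/big_ind: _ => [|x y Mx My|i _]; first exact: lspan0.
    by rewrite -[x]scale1r; exact: lspan_lin.
  rewrite -[_ *: _]addr0; apply: lspan_lin; last exact: lspan0.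
  have [_ Mi] := riM i; apply: M_chain_le Mi.
  by apply: leq_trans (ltnW r0r); exact: (leq_bigmax i).
by case=> Mv vd vh; split=> //; exists r => //; lia.
Qed.

Lemma parityE D : parity D = (\sum_a odd (beta D a))%N.
Proof.
rewrite /parity -sum1_card big_mkcond; apply: eq_bigr => a _.
by rewrite inE; case: odd.
Qed.

Lemma wd_fD D r h m N' : (total D + 2 * r <= h.*2)%N -> (h.*2.*2 < N'.+1)%N ->
  4 * wd h (sea (m := m) N' (fD h D r)) + (parity D)%:Z =
  \sum_a ((beta D a + 2 * r) * (beta D a + 2 * r))%N%:Z.
Proof.
move=> Dr BN; rewrite parityE -[X in _ + X]natz natr_sum /wd.
rewrite mulr_sumr -big_split; apply: eq_bigr => a _ /=.
rewrite -energy_vac (st_sea m BN Dr) oddD mul2n odd_double addbF natz.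
by congr (4 * energy (vac _) + _); lia.
Qed.

Lemma wh_fD D r h m N' : (total D + 2 * r <= h.*2)%N -> (h.*2.*2 < N'.+1)%N ->
  wh h (sea (m := m) N' (fD h D r)) = - (\sum_a (beta D a + 2 * r))%N%:Z.
Proof.
move=> Dr BN; rewrite -[X in - X]natz natr_sum -sumrN.
apply: eq_bigr => a _; rewrite (st_sea m BN Dr) natz -[RHS]charge_vac.
by congr (charge (vac _)); lia.
Qed.

Lemma sum_ind (a : 'I_k) t : (t <= k.+1)%N ->
  (\sum_(j < k.+1 | a < j) (j.+1 == t) = (a.+1 < t))%N.
Proof.
case: t => [|t] tk; first by rewrite big1.
rewrite big_mkcond (bigD1 (Ordinal tk)) //= eqxx big1 => [|j]; first by rewrite addn0; case: ifP; lia.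
by rewrite -val_eqE /= eqSS => /negPf->; rewrite if_same.
Qed.

Lemma sum_ind_le n t : (\sum_(j < n) (j.+1 == t) <= 1)%N.
Proof.
case: t => [|t]; first by rewrite big1.
have [tn|nt] := ltnP t n; last by rewrite big1 // => j _; have := ltn_ord j; lia.
rewrite (bigD1 (Ordinal tn)) //= eqxx big1 // => j.
by rewrite -val_eqE /= eqSS => /negPf->.
Qed.

End Chain.

(* The entries d_1, ..., d_{k+1} are indexed from 0 by j : 'I_k.+1, so that
   j.+1 is the paper's index; s is the paper's s. *)
Theorem proposition5p1 (R : realType) (k s : nat) (d : {ffun 'I_k.+1 -> nat}) :
  (2 <= k)%N -> (2 <= s <= k)%N ->
  let D : {ffun 'I_k.+1 -> nat} := [ffun j => d j + 2 * (j.+1 == s)]%N in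
  let D' : {ffun 'I_k.+1 -> nat} := d in
  let D'' : {ffun 'I_k.+1 -> nat} :=
    [ffun j => d j + (j.+1 == s.-1) + (j.+1 == s.+1)]%N in
  let ds : nat := d (inord s.-1) in
  let c : rat := ((parity D'')%:R - (parity D)%:R) / 4 + (ds%:R + 1) / 2 in
  forall a b : rat,
    ch (L D (complex R)) a b
      = (ch (L D' (complex R)) a b + qmul c (ch (L D'' (complex R))) a b)%N.
Proof.
move=> k2 sk D D' D'' ds c a b; rewrite /qmul.
have cE : c = ((parity D'')%:R - (parity D)%:R) / 4 + (ds%:R + 1) / 2 by [].
clearbody c.
(* The transport goes from component s to component s - 1, whose indices from 0 are [s - 1] and
   [s - 2]. *)
have a0k : (s - 2 < k)%N by lia.
have c0k : (s - 1 < k)%N by lia.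
pose a0 : 'I_k := Ordinal a0k; pose c0 : 'I_k := Ordinal c0k.
have betaD i : beta D i = (beta d i + 2 * (i.+1 < s))%N.
  rewrite /beta -sum_ind; last by lia.
  by rewrite big_distrr -big_split; apply: eq_bigr => j _; rewrite ffunE.
have betaD'' i : beta D'' i = (beta d i + (i.+1 < s.-1) + (i.+1 < s.+1))%N.
  rewrite /beta -!sum_ind; try by lia.
  by rewrite -!big_split; apply: eq_bigr => j _; rewrite ffunE.
have totD : (total D <= total d + 2)%N.
  rewrite /total; under eq_bigr do rewrite ffunE.
  by rewrite big_split -big_distrr /= leq_add2l (leq_mul2l 2 _ 1) sum_ind_le.
have totD'' : (total D'' <= total d + 2)%N.
  rewrite /total; under eq_bigr do rewrite ffunE.
  by rewrite !big_split /= -addnA leq_add2l (leq_add (sum_ind_le _ _) (sum_ind_le _ _)).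
rewrite /D' {D'}; clearbody D D''.
have beta_mono (i j : 'I_k) : (i <= j)%N -> (beta d j <= beta d i)%N.
  move=> ij; rewrite /beta [leqLHS]big_mkcond [leqRHS]big_mkcond; apply: leq_sum => l _.
  by case: ifP => // jl; rewrite (leq_ltn_trans ij jl).
have beta_ds : beta d a0 = (beta d c0 + ds)%N.
  have sk1 : (s - 1 < k.+1)%N by lia.
  rewrite /beta (bigD1 (Ordinal sk1)) /=; last by lia.
  rewrite addnC; congr (_ + _)%N.
    by apply: eq_bigl => j; rewrite -val_eqE /=; lia.
  by congr (d _); apply: val_inj; rewrite /= inordK; lia.
have [r1 H1] := @ch_L (complex R) k D a b.
have [r2 H2] := @ch_L (complex R) k d a b.
have [r3 H3] := @ch_L (complex R) k D'' (a - c) b.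
(* Beyond the three stabilisation thresholds; the window below is deep enough for all three
   modules. *)
pose r := maxn r1 (maxn r2 r3).
pose h := (total d + 2 + r)%N; pose m := (k * h.*2).+1; pose N' := h.*2.*2.
have BN : (h.*2.*2 < N'.+1)%N by [].
have tD : (total D + 2 * r <= h.*2)%N by lia.
have tD' : (total d + 2 * r <= h.*2)%N by lia.
have tD'' : (total D'' + 2 * r <= h.*2)%N by lia.
have e1 := dimP (@has_dim_weight (complex R) k m h N' BN D r a b tD).
have e2 := dimP (@has_dim_weight (complex R) k m h N' BN d r a b tD').
have e3 := dimP (@has_dim_weight (complex R) k m h N' BN D'' r (a - c) b tD'').
have h1 := etrans (H1 r (ltac:(by rewrite /r; lia))) e1.
have h2 := etrans (H2 r (ltac:(by rewrite /r; lia))) e2.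
have h3 := etrans (H3 r (ltac:(by rewrite /r; lia))) e3.
apply: (etrans h1); apply/esym; apply: (etrans (congr2 addn h2 h3)); apply/esym.
have b0 := beta_total D a0; have b1 := beta_total D c0.
(* [D''] is [D] with one fermion moved from [c0] to [a0]: a filling is [B] minus [beta] minus
   [2 * r]. *)
have fmove i : (beta D i + (i == c0) = beta D'' i + (i == a0))%N.
  by rewrite betaD betaD'' -!val_eqE /=; lia.
have betaa : beta D a0 = (beta d a0 + 2)%N by rewrite betaD /=; lia.
have betac : beta D c0 = beta d c0 by rewrite betaD /=; lia.
(* Components up to [a0] are at least as deep as [a0], the others at most as deep as [c0]: this is
   the gap condition, and shows which components [raise] changes. *)
have beta_cmp i : beta D i = (beta d i + 2)%N /\ (beta D a0 <= beta D i)%N \/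
    beta D i = beta d i /\ (beta D i <= beta D c0)%N.
  have [ia|ai] := leqP i a0; [left|right]; rewrite ?betaa ?betac betaD; split.
  - by move: ia => /=; lia.
  - by have := beta_mono i a0 ia; move: ia => /=; lia.
  - by move: ai => /=; lia.
  - have ci : (c0 <= i)%N by move: ai => /=; lia.
    by have := beta_mono c0 i ci; move: ai => /=; lia.
have f1E : fD h d r = raise (fD h D r) (fD h D r (lshift m a0)) :> ('I_(k + m) -> nat).
  apply/funext => z; rewrite /raise fD_lshift; have [i ->|i ->] := split_ordP z; rewrite ?fD_rshift ?fD_lshift.
    by have := beta_total D i; case: (beta_cmp i) => -[-> cmp]; lia.
  by lia.
have f2E : fD h D'' r = move (fD h D r) (lshift m a0) (lshift m c0) :> ('I_(k + m) -> nat).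
  apply/funext => z; rewrite /move; have [i ->|i ->] := split_ordP z.
    rewrite !fD_lshift !(inj_eq (@lshift_inj _ _)); have := fmove i.
    by have := beta_total D i; have := beta_total D'' i; case: (i == a0); case: (i == c0); lia.
  by rewrite !fD_rshift !eq_rlshift; lia.
rewrite f1E f2E; apply: rank_PW; first exact: BN.
- exact: fD_le.
- by apply: sum_fD_lt.
- by rewrite !fD_lshift; lia.
- move=> z; rewrite !fD_lshift; have [i ->|i ->] := split_ordP z; rewrite ?fD_rshift ?fD_lshift.
    by have := beta_total D i; case: (beta_cmp i) => -[_ cmp]; lia.
  by lia.
- exact: Mcyc_good.
- by rewrite -f2E; exact: Mcyc_good.
- rewrite -f2E; have W1 := wd_fD m tD BN; have W2 := wd_fD m tD'' BN.
  (* For A and C the depths of [a0] and [c0], replacing them by A - 1 and C + 1 lowers the sum of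
     squares by 2(A - C) - 2, and A - C is [ds + 2]. *)
  have sqE : \sum_i ((beta D i + 2 * r) * (beta D i + 2 * r))%N%:Z =
      \sum_i ((beta D'' i + 2 * r) * (beta D'' i + 2 * r))%N%:Z + (2 * ds%:Z + 2).
    have ca : c0 != a0 by rewrite -val_eqE /=; lia.
    rewrite (bigD1 a0) //= (bigD1 c0) //= [in RHS](bigD1 a0) //= [in RHS](bigD1 c0) //=.
    rewrite [X in _ + (_ + X)](eq_bigr (fun i => ((beta D'' i + 2 * r) * (beta D'' i + 2 * r))%N%:Z)).
      have := fmove a0; have := fmove c0; rewrite !eqxx (negPf ca) eq_sym (negPf ca).
      by rewrite betaa betac beta_ds; move: (\sum_(_ < _ | _) _) => z; nia.
    by move=> i /andP[ia ic]; have := fmove i; rewrite (negPf ia) (negPf ic) !addn0 => ->.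
  (* Dividing the resulting identity by 4 gives the exponent [c] as the difference of energies. *)
  rewrite sqE -W2 in W1; rewrite cE; move: W1; move: (wd _ _) (wd _ _) => z1 z2 W1.
  have := congr1 (fun z : int => z%:~R : rat) W1.
  have q2 : 2%:~R = 2 :> rat by [].
  have q4 : 4%:~R = 4 :> rat by [].
  rewrite !rmorphD !rmorphM /= -[(parity D)%:~R]pmulrn -[(parity D'')%:~R]pmulrn -[ds%:~R]pmulrn q2 q4 ?mulr1z.
  by move=> e4; lra.
- rewrite -f2E (wh_fD m tD BN) (wh_fD m tD'' BN); congr (- _%:Z).
  have : (\sum_i (beta D i + 2 * r + (i == c0) * 1) = \sum_i (beta D'' i + 2 * r + (i == a0) * 1))%N.
    by apply: eq_bigr => i _; have := fmove i; case: (i == c0); case: (i == a0); lia.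
  by rewrite !big_split /= !sum_mem1 => /addIn.
Qed.
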